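(* Let $T$ be a type, $T_{rec}=\mu X.[T,X]^{\bullet 1}$, $\Gamma_{ext}=\mathit{in}:[T]^\omega,\ \mathit{out}:[T]^\omega$ and $\Gamma_{Frn}=\mathit{in}:[T]^\omega,\ b:[T_{rec}]^\omega,\ c_1:[T,T_{rec}]^1$, and let $M$ be a resource environment containing $\mathit{in},\mathit{out},b,d,c_1$. Then $(\Gamma_{ext},\Gamma_{Frn})\models M\triangleright\mathrm{eBk}''(c_1)\ \sqsubseteq^0_{bis}\ M\triangleright\mathrm{Bck}''(c_1)$, where $\mathrm{eBk}''(c_1)=c_1?(y,z).\,\mathsf{free}\,c_1.\,\mathit{out}!\langle y\rangle.(\mathrm{eBk}\parallel d!\langle z\rangle)$ and $\mathrm{Bck}''(c_1)=c_1?(y,z).\,\mathit{out}!\langle y\rangle.(\mathrm{Bck}\parallel d!\langle z\rangle)$.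
   Context: Calculus. Fix disjoint countably infinite sets $\mathcal C$ of channel names ($c,d$) and $\mathcal V$ of variables ($x,y,z,w$); identifiers $u,v$ range over $\mathcal C\cup\mathcal V$. Processes: $P,Q::= u!\langle\vec v\rangle.P \mid u?(\vec x).P\mid \mathbf 0\mid \mathsf{if}\ u=v\ \mathsf{then}\ P\ \mathsf{else}\ Q\mid \mathsf{rec}\,w.P\mid w\mid P\parallel Q\mid \mathsf{alloc}\,x.P\mid \mathsf{free}\,u.P$ (input binds $\vec x$, $\mathsf{rec}$ binds $w$, $\mathsf{alloc}$ binds $x$; no name restriction); $u!\langle\vec v\rangle$ abbreviates $u!\langle\vec v\rangle.\mathbf 0$. A resource environment $M$ is a set of allocated channels (infinitely many unallocated); $M,c$ denotes $M\cup\{c\}$ with $c\notin M$. A system $M\triangleright P$ pairs a resource environment with a closed process. Types: attributes $a::=\omega\mid1\mid\bullet i$ ($i\in\mathbb N$, $\bullet=\bullet0$); types $T::=U\mid\mathsf{proc}$, $U::=[\vec U]^a\mid\mu X.U\mid X$, closed contractive, up to equi-recursive equality $\sim$. Environments $\Gamma$: finite multisets of $u:T$; $(\Gamma,\Delta)$ is concatenation. Splitting $[\vec T]^\omega=[\vec T]^\omega\circ[\vec T]^\omega$, $\mathsf{proc}=\mathsf{proc}\circ\mathsf{proc}$, $[\vec T]^{\bullet i}=[\vec T]^1\circ[\vec T]^{\bullet(i+1)}$; subtyping generated by $\bullet i\preceq\bullet(i+1)$, $\bullet i\preceq\omega$, $\omega\preceq1$ lifted to channel types. $\prec$: least reflexive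 transitive relation with $\Gamma,u:T\prec\Gamma,u:T_1,u:T_2$ and converse when $T=T_1\circ T_2$; $\Gamma,u:T_1\prec\Gamma,u:T_2$ when $T_1\sim T_2$ or $T_1\preceq T_2$; $\Gamma,u:T\prec\Gamma$; $\Gamma,u:[\vec T_1]^\bullet\prec\Gamma,u:[\vec T_2]^\bullet$. Decrement $(u:[\vec T]^a-1)$: empty if $a=1$, $u:[\vec T]^\omega$ if $a=\omega$, $u:[\vec T]^{\bullet i}$ if $a=\bullet(i+1)$, undefined if $a=\bullet$. Typing $\Gamma\vdash P$: $\Gamma,(u:[\vec T]^a-1)\vdash P\Rightarrow\Gamma,u:[\vec T]^a,\vec v:\vec T\vdash u!\langle\vec v\rangle.P$; $\Gamma,(u:[\vec T]^a-1),\vec x:\vec T\vdash P\Rightarrow\Gamma,u:[\vec T]^a\vdash u?(\vec x).P$; $\Gamma_1\vdash P,\Gamma_2\vdash Q\Rightarrow\Gamma_1,\Gamma_2\vdash P\parallel Q$; $u,v\in\mathrm{dom}(\Gamma),\Gamma\vdash P,\Gamma\vdash Q\Rightarrow\Gamma\vdash\mathsf{if}\ u=v\ \mathsf{then}\ P\ \mathsf{else}\ Q$; $\Gamma^\omega,w:\mathsf{proc}\vdash P\Rightarrow\Gamma^\omega\vdash\mathsf{rec}\,w.P$ ($\Gamma^\omega$ only unrestricted assumptions); $w:\mathsf{proc}\vdash w$; $\Gamma\vdash P\Rightarrow\Gamma,u:[\vec T]^\bullet\vdash\mathsf{free}\,u.P$; $\Gamma,x:[\vec T]^\bullet\vdash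 P\Rightarrow\Gamma\vdash\mathsf{alloc}\,x.P$; $\emptyset\vdash\mathbf0$; $\Gamma'\vdash P,\Gamma\prec\Gamma'\Rightarrow\Gamma\vdash P$. $\Gamma$ consistent iff some $\Gamma'$ with each identifier at most once has $\Gamma'\prec\Gamma$. $\Gamma\vdash M\triangleright P$ iff $\Gamma\vdash P$, $\mathrm{dom}(\Gamma)\subseteq M$, $\Gamma$ consistent. Configuration $\Gamma\triangleleft M\triangleright P$: $\mathrm{dom}(\Gamma)\subseteq M$ and some $\Delta$ with $(\Gamma,\Delta)$ consistent and $\Delta\vdash M\triangleright P$. LTS: pre-transitions $\Gamma\triangleleft M\triangleright P\xrightarrow{\mu}{}^{\mathrm{pre}}_k\Gamma'\triangleleft M'\triangleright P'$, $\mu::=c!\vec d\mid c?\vec d\mid\tau\mid\mathsf{alloc}\mid\mathsf{free}\,c\mid\mathsf{env}$: output $\Gamma,c:[\vec T]^a\triangleleft M\triangleright c!\langle\vec d\rangle.P\xrightarrow{c!\vec d}_0\Gamma,(c:[\vec T]^a-1),\vec d:\vec T\triangleleft M\triangleright P$; input $\Gamma,c:[\vec T]^a,\vec d:\vec T\triangleleft M\triangleright c?(\vec x).P\xrightarrow{c?\vec d}_0\Gamma,(c:[\vec T]^a-1)\triangleleft M\triangleright P\{\vec d/\vec x\}$; communication: if $\Gamma_1\triangleleft M\triangleright P\xrightarrow{c!\vec d}_0\Gamma'_1\triangleleft M\triangleright P'$ and $\Gamma_2\triangleleft M\triangleright Q\xrightarrow{c?\vec d}_0\Gamma'_2\triangleleft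 M\triangleright Q'$ then $\Gamma\triangleleft M\triangleright P\parallel Q\xrightarrow{\tau}_0\Gamma\triangleleft M\triangleright P'\parallel Q'$ for any $\Gamma$ (and symmetrically); parallel closure on either side; $\Gamma\triangleleft M\triangleright P\xrightarrow{\mathsf{env}}_0\Gamma'\triangleleft M\triangleright P$ for $\Gamma\prec\Gamma'$; cost-0 $\tau$ for recursion unfolding and conditionals (then-branch for $\mathsf{if}\ c=c$, $c\in M$; else-branch for $\mathsf{if}\ c=d$, $c\neq d$, $c,d\in M$); $\Gamma\triangleleft M\triangleright\mathsf{alloc}\,x.P\xrightarrow{\tau}_{+1}\Gamma\triangleleft M,c\triangleright P\{c/x\}$; $\Gamma\triangleleft M\triangleright P\xrightarrow{\mathsf{alloc}}_{+1}\Gamma,c:[\vec T]^\bullet\triangleleft M,c\triangleright P$; $\Gamma\triangleleft M,c\triangleright\mathsf{free}\,c.P\xrightarrow{\tau}_{-1}\Gamma\triangleleft M\triangleright P$; $\Gamma,c:[\vec T]^\bullet\triangleleft M,c\triangleright P\xrightarrow{\mathsf{free}\,c}_{-1}\Gamma\triangleleft M\triangleright P$. Transitions $\Gamma\triangleleft M\triangleright P\xrightarrow{\mu}_kX$ iff $\Gamma\triangleleft(M\triangleright P)\sigma\xrightarrow{\mu}{}^{\mathrm{pre}}_kX$ for some bijective renaming $\sigma$ of channels fixing all channels in $\mathrm{dom}(\Gamma)$. Weak $\xRightarrow{\mu}_k$: $\tau$-steps, one $\mu$-step, $\tau$-steps, total cost $k$; $\hat\mu=\mu$ for $\mu\ne\tau$,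 and $\xRightarrow{\hat\tau}_k$ is zero or more $\tau$-steps of total cost $k$. Bisimulation: an amortised typed bisimulation is a set $\mathcal R$ of quadruples $(\Gamma,n,S,T)$, $n\in\mathbb N$, with $\Gamma\triangleleft S,\Gamma\triangleleft T$ configurations, such that whenever $(\Gamma,n,M\triangleright P,N\triangleright Q)\in\mathcal R$: each $\Gamma\triangleleft M\triangleright P\xrightarrow{\mu}_k\Gamma'\triangleleft M'\triangleright P'$ is matched by some $\Gamma\triangleleft N\triangleright Q\xRightarrow{\hat\mu}_l\Gamma'\triangleleft N'\triangleright Q'$ with $(\Gamma',n+l-k,M'\triangleright P',N'\triangleright Q')\in\mathcal R$, and each $\Gamma\triangleleft N\triangleright Q\xrightarrow{\mu}_l\Gamma'\triangleleft N'\triangleright Q'$ is matched by some $\Gamma\triangleleft M\triangleright P\xRightarrow{\hat\mu}_k\Gamma'\triangleleft M'\triangleright P'$ with $(\Gamma',n+l-k,M'\triangleright P',N'\triangleright Q')\in\mathcal R$ (credits stay in $\mathbb N$). $\Gamma\models S\sqsubseteq^n_{bis}T$ iff some amortised typed bisimulation contains $(\Gamma,n,S,T)$. Processes (with $\mathit{in},\mathit{out},b,d,c_1$ distinct channels): $\mathrm{Bck}=\mathsf{rec}\,w.\,d?(x).\,x?(y,z).\,\mathit{out}!\langle y\rangle.(w\parallel d!\langle z\rangle)$; $\mathrm{eBk}=\mathsf{rec}\,w.\,d?(x).\,x?(y,z).\,\mathsf{free}\,x.\,\mathit{out}!\langle y\rangle.(w\parallel d!\langle z\rangle)$. *)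

(* Defs.v *)
(* MathComp, with classical sets for resource environments and finmap's finite
   multisets for typing environments. *)
From Stdlib Require List.
From HB Require Import structures.
From mathcomp Require Import all_boot all_order all_algebra.
From mathcomp Require Import finmap multiset.
From mathcomp Require Import boolp classical_sets cardinality.

Set Implicit Arguments.
Unset Strict Implicit.
Unset Printing Implicit Defensive.

Import GRing.Theory.

Declare Scope pic_scope.
Local Open Scope classical_set_scope.
Local Open Scope mset_scope.
Local Open Scope pic_scope.

(** * Processes *)

Definition chan : Type := nat.
Definition var : Type := nat.
HB.instance Definition _ := Countable.copy chan nat.
HB.instance Definition _ := Countable.copy var nat.

Inductive ident : Type := Ch of chan | Va of var.

Definition sum_of_ident (u : ident) : chan + var :=
  match u with Ch c => inl c | Va x => inr x end.
Definition ident_of_sum (s : chan + var) : ident :=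
  match s with inl c => Ch c | inr x => Va x end.
Lemma sum_of_identK : cancel sum_of_ident ident_of_sum.
Proof. by case. Qed.
HB.instance Definition _ := Countable.copy ident (can_type sum_of_identK).

(* Raw named syntax.  The transition rules below only ever substitute channels,
   or closed recursive processes, so substitution needs no alpha-conversion. *)
Inductive proc : Type :=
| Out of ident & seq ident & proc
| In of ident & seq var & proc
| PNil
| If of ident & ident & proc & proc
| Rec of var & proc
| PVar of var
| Par of proc & proc
| Alloc of var & proc
| Free of ident & proc.

Definition ident_vars (us : seq ident) : seq var :=
  pmap (fun u => if u is Va x then Some x else None) us.

Fixpoint fv (P : proc) : seq var :=
  match P with
  | Out u vs Q => ident_vars (u :: vs) ++ fv Q
  | In u xs Q => ident_vars [:: u] ++ [seq v <- fv Q | v \notin xs]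
  | PNil => [::]
  | If u v Q1 Q2 => ident_vars [:: u; v] ++ fv Q1 ++ fv Q2
  | Rec w Q => [seq v <- fv Q | v != w]
  | PVar w => [:: w]
  | Par Q1 Q2 => fv Q1 ++ fv Q2
  | Alloc x Q => [seq v <- fv Q | v != x]
  | Free u Q => ident_vars [:: u] ++ fv Q
  end.

Definition closed_proc (P : proc) : Prop := fv P = [::].

Definition hide_vars (xs : seq var) (f : var -> ident) : var -> ident :=
  fun v => if v \in xs then Va v else f v.

Definition subst_ident (f : var -> ident) (u : ident) : ident :=
  match u with Ch c => Ch c | Va x => f x end.

Fixpoint subst (f : var -> ident) (P : proc) : proc :=
  match P with
  | Out u vs Q => Out (subst_ident f u) (map (subst_ident f) vs) (subst f Q)
  | In u xs Q => In (subst_ident f u) xs (subst (hide_vars xs f) Q)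
  | PNil => PNil
  | If u v Q1 Q2 =>
      If (subst_ident f u) (subst_ident f v) (subst f Q1) (subst f Q2)
  | Rec w Q => Rec w (subst (hide_vars [:: w] f) Q)
  | PVar w => PVar w
  | Par Q1 Q2 => Par (subst f Q1) (subst f Q2)
  | Alloc x Q => Alloc x (subst (hide_vars [:: x] f) Q)
  | Free u Q => Free (subst_ident f u) (subst f Q)
  end.

(* the simultaneous substitution {ds/xs} *)
Definition chan_subst (xs : seq var) (ds : seq chan) : var -> ident :=
  fun v => if v \in xs then Ch (nth 0 ds (index v xs)) else Va v.

Fixpoint subst_proc (w : var) (R P : proc) : proc :=
  match P with
  | Out u vs Q => Out u vs (subst_proc w R Q)
  | In u xs Q => In u xs (if w \in xs then Q else subst_proc w R Q)
  | PNil => PNil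
  | If u v Q1 Q2 => If u v (subst_proc w R Q1) (subst_proc w R Q2)
  | Rec w' Q => Rec w' (if w == w' then Q else subst_proc w R Q)
  | PVar w' => if w == w' then R else PVar w'
  | Par Q1 Q2 => Par (subst_proc w R Q1) (subst_proc w R Q2)
  | Alloc x Q => Alloc x (if w == x then Q else subst_proc w R Q)
  | Free u Q => Free u (subst_proc w R Q)
  end.

Definition rename_ident (s : chan -> chan) (u : ident) : ident :=
  match u with Ch c => Ch (s c) | Va x => Va x end.

Fixpoint rename (s : chan -> chan) (P : proc) : proc :=
  match P with
  | Out u vs Q => Out (rename_ident s u) (map (rename_ident s) vs) (rename s Q)
  | In u xs Q => In (rename_ident s u) xs (rename s Q)
  | PNil => PNil
  | If u v Q1 Q2 =>
      If (rename_ident s u) (rename_ident s v) (rename s Q1) (rename s Q2)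
  | Rec w Q => Rec w (rename s Q)
  | PVar w => PVar w
  | Par Q1 Q2 => Par (rename s Q1) (rename s Q2)
  | Alloc x Q => Alloc x (rename s Q)
  | Free u Q => Free (rename_ident s u) (rename s Q)
  end.

(** * Types *)

(* [Unr] is omega, [Aff] is 1 and [Uni i] is the attribute "bullet i". *)
Inductive attr : Type := Unr | Aff | Uni of nat.

(* Type variables are de Bruijn indices, [TMu] being the only binder. *)
Inductive ty : Type :=
| TChan of seq ty & attr
| TMu of ty
| TVar of nat.

Definition nat_of_attr (a : attr) : nat :=
  match a with Unr => 0 | Aff => 1 | Uni i => i.+2 end.
Definition attr_of_nat (n : nat) : attr :=
  match n with 0 => Unr | 1 => Aff | i.+2 => Uni i end.
Lemma nat_of_attrK : cancel nat_of_attr attr_of_nat.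
Proof. by case. Qed.
HB.instance Definition _ := Countable.copy attr (can_type nat_of_attrK).

Fixpoint ty_nested_ind (Q : ty -> Prop)
  (Hchan : forall Us a, foldr (fun U H => Q U /\ H) True Us -> Q (TChan Us a))
  (Hmu : forall U, Q U -> Q (TMu U)) (Hvar : forall i, Q (TVar i))
  (U : ty) {struct U} : Q U :=
  match U with
  | TChan Us a => Hchan Us a
      ((fix go (Vs : seq ty) : foldr (fun U H => Q U /\ H) True Vs :=
          match Vs with
          | [::] => I
          | V :: Vs' => conj (ty_nested_ind Hchan Hmu Hvar V) (go Vs')
          end) Us)
  | TMu V => Hmu V (ty_nested_ind Hchan Hmu Hvar V)
  | TVar i => Hvar i
  end.

Fixpoint tree_of_ty (U : ty) : GenTree.tree nat :=
  match U with
  | TChan Us a => GenTree.Node (nat_of_attr a).+1 (map tree_of_ty Us)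
  | TMu V => GenTree.Node 0 [:: tree_of_ty V]
  | TVar i => GenTree.Leaf i
  end.
Fixpoint ty_of_tree (t : GenTree.tree nat) : ty :=
  match t with
  | GenTree.Leaf i => TVar i
  | GenTree.Node 0 ts => TMu (head (TVar 0) (map ty_of_tree ts))
  | GenTree.Node k.+1 ts => TChan (map ty_of_tree ts) (attr_of_nat k)
  end.
Lemma tree_of_tyK : cancel tree_of_ty ty_of_tree.
Proof.
elim/ty_nested_ind => [Us a IH|U IH|i] //=; last by rewrite IH.
rewrite nat_of_attrK; congr TChan.
by elim: Us IH => //= U Us IHs [-> /IHs ->].
Qed.
HB.instance Definition _ := Countable.copy ty (can_type tree_of_tyK).

Fixpoint closed_at (n : nat) (U : ty) : bool :=
  match U with
  | TChan Us _ => all (closed_at n) Us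
  | TMu V => closed_at n.+1 V
  | TVar i => i < n
  end.

(* index [n] does not occur in [U] outside a channel constructor *)
Fixpoint guarded (n : nat) (U : ty) : bool :=
  match U with
  | TChan _ _ => true
  | TMu V => guarded n.+1 V
  | TVar i => i != n
  end.

Fixpoint contractive (U : ty) : bool :=
  match U with
  | TChan Us _ => all contractive Us
  | TMu V => guarded 0 V && contractive V
  | TVar _ => true
  end.

(* closed contractive channel types *)
Record chty : Type := ChTy {
  ty_of_chty :> ty;
  chtyP : closed_at 0 ty_of_chty && contractive ty_of_chty }.
HB.instance Definition _ := [isSub for ty_of_chty].
HB.instance Definition _ := [Countable of chty by <:].

Lemma chan_chtyP (Us : seq chty) (a : attr) :
  closed_at 0 (TChan (map ty_of_chty Us) a)
  && contractive (TChan (map ty_of_chty Us) a).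
Proof.
by apply/andP; split; apply/allP => ? /mapP[U _ ->]; case/andP: (chtyP U).
Qed.

Definition chan_ty (Us : seq chty) (a : attr) : chty := ChTy (chan_chtyP Us a).
Notation "[ Us ]^ a" := (chan_ty Us a)
  (at level 0, Us at level 200, a at level 0, format "[ Us ]^ a") : pic_scope.

(* Only closed types are ever substituted, so [V] is not lifted under [TMu]. *)
Fixpoint ty_subst (n : nat) (V U : ty) : ty :=
  match U with
  | TChan Us a => TChan (map (ty_subst n V) Us) a
  | TMu W => TMu (ty_subst n.+1 V W)
  | TVar i => if i == n then V else TVar (if n < i then i.-1 else i)
  end.

Inductive unfolds_to : ty -> seq ty -> attr -> Prop :=
| unfolds_chan Us a : unfolds_to (TChan Us a) Us a
| unfolds_mu U Us a :
    unfolds_to (ty_subst 0 (TMu U) U) Us a -> unfolds_to (TMu U) Us a.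

(* Equi-recursive equality: the infinite unfoldings are the same tree. *)
Definition ty_bisimulation (R : ty -> ty -> Prop) : Prop :=
  forall U V, R U V -> exists Us Vs a,
    [/\ unfolds_to U Us a, unfolds_to V Vs a & List.Forall2 R Us Vs].
Definition ty_eq (U V : chty) : Prop :=
  exists R : ty -> ty -> Prop, ty_bisimulation R /\ R U V.
Notation "U ∼ V" := (ty_eq U V) (at level 70) : pic_scope.

Inductive typ : Type := TyCh of chty | TyProc.
Coercion TyCh : chty >-> typ.

Definition option_of_typ (T : typ) : option chty :=
  if T is TyCh U then Some U else None.
Definition typ_of_option (o : option chty) : typ :=
  if o is Some U then TyCh U else TyProc.
Lemma option_of_typK : cancel option_of_typ typ_of_option.
Proof. by case. Qed.
HB.instance Definition _ := Countable.copy typ (can_type option_of_typK).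

Inductive split_typ : typ -> typ -> typ -> Prop :=
| split_unr Us : split_typ [Us]^Unr [Us]^Unr [Us]^Unr
| split_proc : split_typ TyProc TyProc TyProc
| split_uni Us i :
    split_typ [Us]^(Uni i) [Us]^Aff [Us]^(Uni i.+1).

Inductive sub_attr : attr -> attr -> Prop :=
| sub_refl a : sub_attr a a
| sub_trans a b c : sub_attr a b -> sub_attr b c -> sub_attr a c
| sub_uni i : sub_attr (Uni i) (Uni i.+1)
| sub_uni_unr i : sub_attr (Uni i) Unr
| sub_unr_aff : sub_attr Unr Aff.

(** * Typing *)

Definition env : Type := {mset (ident * typ)}.

Definition assume (u : ident) (T : typ) : env := [mset (u, T)].
Notation "u :- T" := (assume u T) (at level 45) : pic_scope.

(* the environment vs : Us; always used with [size vs = size Us] *)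
Definition binds (vs : seq ident) (Us : seq chty) : env :=
  seq_mset (zip vs (map TyCh Us)).

Definition dom (G : env) : set ident := [set u | exists T, (u, T) \in G].

Definition dom_in (G : env) (M : set chan) : Prop :=
  forall u, dom G u -> exists2 c, u = Ch c & M c.

Inductive struct_le : env -> env -> Prop :=
| str_refl G : struct_le G G
| str_trans G1 G2 G3 : struct_le G1 G2 -> struct_le G2 G3 -> struct_le G1 G3
| str_split (G : env) u T T1 T2 : split_typ T T1 T2 ->
    struct_le (G `+` u :- T) (G `+` u :- T1 `+` u :- T2)
| str_join (G : env) u T T1 T2 : split_typ T T1 T2 ->
    struct_le (G `+` u :- T1 `+` u :- T2) (G `+` u :- T)
| str_eq (G : env) u U1 U2 : U1 ∼ U2 ->
    struct_le (G `+` u :- U1) (G `+` u :- U2)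
| str_sub (G : env) u Us a1 a2 : sub_attr a1 a2 ->
    struct_le (G `+` u :- [Us]^a1) (G `+` u :- [Us]^a2)
| str_weak (G : env) u T : struct_le (G `+` u :- T) G
| str_rev (G : env) u Us1 Us2 :
    struct_le (G `+` u :- [Us1]^(Uni 0)) (G `+` u :- [Us2]^(Uni 0)).
Notation "G1 ≺ G2" := (struct_le G1 G2) (at level 70) : pic_scope.

(* (u : [Us]^a - 1) *)
Definition decr (u : ident) (Us : seq chty) (a : attr) : option env :=
  match a with
  | Aff => Some mset0
  | Unr => Some (u :- [Us]^Unr)
  | Uni i.+1 => Some (u :- [Us]^(Uni i))
  | Uni 0 => None
  end.

Definition unrestricted (G : env) : Prop :=
  forall u T, (u, T) \in G -> T = TyProc \/ exists Us, T = TyCh [Us]^Unr.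

(* The conditions [~ dom _ (Va x)] and [uniq xs] are the usual conventions on
   bound variables, explicit because the syntax is named. *)
Inductive typed : env -> proc -> Prop :=
| t_out (G : env) D u Us a vs P : size vs = size Us -> decr u Us a = Some D ->
    typed (G `+` D) P ->
    typed (G `+` u :- [Us]^a `+` binds vs Us) (Out u vs P)
| t_in (G : env) D u Us a (xs : seq var) P :
    size xs = size Us -> decr u Us a = Some D -> uniq xs ->
    (forall x : var, x \in xs -> ~ dom (G `+` D) (Va x)) ->
    typed (G `+` D `+` binds (map Va xs) Us) P ->
    typed (G `+` u :- [Us]^a) (In u xs P)
| t_par G1 G2 P Q : typed G1 P -> typed G2 Q -> typed (G1 `+` G2) (Par P Q)
| t_if G u v P Q : dom G u -> dom G v -> typed G P -> typed G Q ->
    typed G (If u v P Q)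
| t_rec G w P : unrestricted G -> ~ dom G (Va w) ->
    typed (G `+` Va w :- TyProc) P -> typed G (Rec w P)
| t_var w : typed (Va w :- TyProc) (PVar w)
| t_free G u Us P : typed G P -> typed (G `+` u :- [Us]^(Uni 0)) (Free u P)
| t_alloc G x Us P : ~ dom G (Va x) -> typed (G `+` Va x :- [Us]^(Uni 0)) P ->
    typed G (Alloc x P)
| t_nil : typed mset0 PNil
| t_str G G' P : typed G' P -> G ≺ G' -> typed G P.

Definition functional (G : env) : Prop := uniq [seq p.1 | p <- enum_mset G].

Definition consistent (G : env) : Prop :=
  exists G' : env, functional G' /\ G' ≺ G.

Definition resource_env (M : set chan) : Prop := infinite_set (~` M)%classic.

(* Systems [M |> P] are raw pairs; being a system proper is [is_system]. *)
Definition system : Type := set chan * proc.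

Definition is_system (S : system) : Prop :=
  resource_env S.1 /\ closed_proc S.2.

Definition typed_system (G : env) (S : system) : Prop :=
  [/\ typed G S.2, dom_in G S.1 & consistent G].

Definition configuration (G : env) (S : system) : Prop :=
  [/\ is_system S, dom_in G S.1
    & exists D : env, consistent (G `+` D) /\ typed_system D S].

(** * Transitions *)

Inductive label : Type :=
| LOut of chan & seq chan
| LIn of chan & seq chan
| LTau
| LAlloc
| LFree of chan
| LEnv.

Inductive pre_step : env -> system -> label -> int -> env -> system -> Prop :=
| s_out (G : env) D M c Us a ds P :
    size ds = size Us -> decr (Ch c) Us a = Some D ->
    pre_step (G `+` Ch c :- [Us]^a) (M, Out (Ch c) (map Ch ds) P)
      (LOut c ds) 0 (G `+` D `+` binds (map Ch ds) Us) (M, P)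
| s_in (G : env) D M c Us a ds xs P :
    size ds = size Us -> size xs = size Us -> decr (Ch c) Us a = Some D ->
    pre_step (G `+` Ch c :- [Us]^a `+` binds (map Ch ds) Us)
      (M, In (Ch c) xs P) (LIn c ds) 0
      (G `+` D) (M, subst (chan_subst xs ds) P)
| s_com_l G G1 G1' G2 G2' M c ds P P' Q Q' :
    pre_step G1 (M, P) (LOut c ds) 0 G1' (M, P') ->
    pre_step G2 (M, Q) (LIn c ds) 0 G2' (M, Q') ->
    pre_step G (M, Par P Q) LTau 0 G (M, Par P' Q')
| s_com_r G G1 G1' G2 G2' M c ds P P' Q Q' :
    pre_step G1 (M, P) (LIn c ds) 0 G1' (M, P') ->
    pre_step G2 (M, Q) (LOut c ds) 0 G2' (M, Q') ->
    pre_step G (M, Par P Q) LTau 0 G (M, Par P' Q')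
| s_par_l G G' M M' mu k P P' Q :
    pre_step G (M, P) mu k G' (M', P') ->
    pre_step G (M, Par P Q) mu k G' (M', Par P' Q)
| s_par_r G G' M M' mu k P Q Q' :
    pre_step G (M, Q) mu k G' (M', Q') ->
    pre_step G (M, Par P Q) mu k G' (M', Par P Q')
| s_env G G' M P : G ≺ G' -> pre_step G (M, P) LEnv 0 G' (M, P)
| s_rec G M w P :
    pre_step G (M, Rec w P) LTau 0 G (M, subst_proc w (Rec w P) P)
| s_then G (M : set chan) c P Q : M c ->
    pre_step G (M, If (Ch c) (Ch c) P Q) LTau 0 G (M, P)
| s_else G (M : set chan) c d P Q : c <> d -> M c -> M d ->
    pre_step G (M, If (Ch c) (Ch d) P Q) LTau 0 G (M, Q)
| s_alloc G (M : set chan) c x P : ~ M c ->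
    pre_step G (M, Alloc x P) LTau 1
      G ((c |` M)%classic, subst (chan_subst [:: x] [:: c]) P)
| s_env_alloc G (M : set chan) c Us P : ~ M c ->
    pre_step G (M, P) LAlloc 1
      (G `+` Ch c :- [Us]^(Uni 0)) ((c |` M)%classic, P)
| s_free G (M : set chan) c P : ~ M c ->
    pre_step G ((c |` M)%classic, Free (Ch c) P) LTau (- 1)%R G (M, P)
| s_env_free (G : env) (M : set chan) c Us P : ~ M c ->
    pre_step (G `+` Ch c :- [Us]^(Uni 0)) ((c |` M)%classic, P)
      (LFree c) (- 1)%R G (M, P).

Definition rename_system (s : chan -> chan) (S : system) : system :=
  ((s @` S.1)%classic, rename s S.2).

Definition step (G : env) (S : system) (mu : label) (k : int)
    (G' : env) (S' : system) : Prop :=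
  exists s : chan -> chan,
    [/\ bijective s, forall c, dom G (Ch c) -> s c = c
      & pre_step G (rename_system s S) mu k G' S'].

Inductive tau_steps : env -> system -> int -> env -> system -> Prop :=
| taus_refl G S : tau_steps G S 0 G S
| taus_step G1 S1 k1 G2 S2 k2 G3 S3 :
    step G1 S1 LTau k1 G2 S2 -> tau_steps G2 S2 k2 G3 S3 ->
    tau_steps G1 S1 (k1 + k2)%R G3 S3.

Definition weak (G : env) (S : system) (mu : label) (k : int)
    (G' : env) (S' : system) : Prop :=
  exists k1 k2 k3 G1 S1 G2 S2,
    [/\ tau_steps G S k1 G1 S1, step G1 S1 mu k2 G2 S2,
        tau_steps G2 S2 k3 G' S' & k = (k1 + k2 + k3)%R].

Definition weak_hat (G : env) (S : system) (mu : label) (k : int)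
    (G' : env) (S' : system) : Prop :=
  if mu is LTau then tau_steps G S k G' S' else weak G S mu k G' S'.

(** * Amortised typed bisimulation *)

Definition amortised_bisim
    (R : env -> nat -> system -> system -> Prop) : Prop :=
  forall G n S T, R G n S T ->
  [/\ configuration G S, configuration G T,
      (forall mu k G' S', step G S mu k G' S' ->
        exists l T' (n' : nat), [/\ weak_hat G T mu l G' T',
          (n'%:Z = n%:Z + l - k)%R & R G' n' S' T'])
    & (forall mu l G' T', step G T mu l G' T' ->
        exists k S' (n' : nat), [/\ weak_hat G S mu k G' S',
          (n'%:Z = n%:Z + l - k)%R & R G' n' S' T'])].

Definition amortised_le (G : env) (n : nat) (S T : system) : Prop :=
  exists R, amortised_bisim R /\ R G n S T.

(** * The buffer back-ends *)

Definition Bck (out d : chan) (x y z w : var) : proc :=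
  Rec w (In (Ch d) [:: x] (In (Va x) [:: y; z]
    (Out (Ch out) [:: Va y] (Par (PVar w) (Out (Ch d) [:: Va z] PNil))))).

Definition eBk (out d : chan) (x y z w : var) : proc :=
  Rec w (In (Ch d) [:: x] (In (Va x) [:: y; z] (Free (Va x)
    (Out (Ch out) [:: Va y] (Par (PVar w) (Out (Ch d) [:: Va z] PNil)))))).

Definition Bck'' (out d : chan) (x y z w : var) (c : chan) : proc :=
  In (Ch c) [:: y; z]
    (Out (Ch out) [:: Va y]
      (Par (Bck out d x y z w) (Out (Ch d) [:: Va z] PNil))).

Definition eBk'' (out d : chan) (x y z w : var) (c : chan) : proc :=
  In (Ch c) [:: y; z] (Free (Ch c)
    (Out (Ch out) [:: Va y]
      (Par (eBk out d x y z w) (Out (Ch d) [:: Va z] PNil)))).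

Lemma closed_at_leq (m n : nat) (U : ty) :
  m <= n -> closed_at m U -> closed_at n U.
Proof.
elim/ty_nested_ind: U m n => [Us a IH|U IH|i] m n le_mn /=.
- by elim: Us IH => //= U Us IHs [IH1 /IHs IH2] /andP[/(IH1 _ _ le_mn)-> /IH2].
- exact: IH.
- by move/leq_trans; apply.
Qed.

Lemma T_recP (T : chty) :
  closed_at 0 (TMu (TChan [:: ty_of_chty T; TVar 0] (Uni 1)))
  && contractive (TMu (TChan [:: ty_of_chty T; TVar 0] (Uni 1))).
Proof.
by case: T => T /= /andP[/(closed_at_leq (leq0n 1)) -> ->].
Qed.

Definition T_rec (T : chty) : chty := ChTy (T_recP T).

Definition Gamma_ext (T : chty) (inp out : chan) : env :=
  Ch inp :- [[:: T]]^Unr `+` Ch out :- [[:: T]]^Unr.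

Definition Gamma_Frn (T : chty) (inp b c1 : chan) : env :=
  Ch inp :- [[:: T]]^Unr `+` Ch b :- [[:: T_rec T]]^Unr
  `+` Ch c1 :- [[:: T; T_rec T]]^Aff.

(* Main.v *)
Require Import Defs.
From Stdlib Require List.
From mathcomp Require Import all_boot all_order all_algebra.
From mathcomp Require Import finmap multiset.
From mathcomp Require Import boolp classical_sets cardinality.
From mathcomp Require Import zify.

(* Both back-ends run through the same sequence of stages, the eager one paying
   -1 in addition when it frees the channel it has just received on; the lazy
   one answers that step by idling, so the credit grows.  The bisimulation
   relates the two back-ends at the same stage, whenever the observer's
   environment together with the assumptions of the stage is consistent and
   does not mention [d].  Consistency is what forces the observer's types: with
   [c : (T, T_rec) bullet 1] on the process side, the observer holds at most an
   affine assumption on [c] with the same payload, and none at all once the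
   process owns [c] uniquely, so freeing [c] cannot be observed.  Renamings are
   absorbed by closing the relation under renaming of the lazy system. *)

Set Implicit Arguments.
Unset Strict Implicit.
Unset Printing Implicit Defensive.

Import GRing.Theory.

Local Open Scope classical_set_scope.
Local Open Scope mset_scope.
Local Open Scope pic_scope.

(** * Equi-recursive types *)

(** Consistency cannot be read off by inverting [≺]: transitivity lets assumptions be split, joined
    and retyped in any order. The way around is an invariant of the list of types that an
    environment assigns to one identifier, preserved by [≺] and true of functional environments. It
    compares payloads, so equi-recursive equality must be an equivalence that respects the head
    attribute; this is the purpose of the preliminaries on unfolding. The relation leaves the credit
    unconstrained. Every matched step changes it by 0 or by +1, the latter when a free of the eager
    side has no counterpart, so a credit that starts in the naturals stays there. *)

Lemma closed_at_guarded (n k : nat) (U : ty) : closed_at n U -> n <= k -> guarded k U.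
Proof.
elim/ty_nested_ind: U n k => [//|U IH|i] n k /=; last by move=> *; lia.
by move=> /IH H le_nk; apply: H.
Qed.

Lemma ty_subst_closed (n : nat) (V U : ty) : closed_at n U -> ty_subst n V U = U.
Proof.
elim/ty_nested_ind: U n => [Us a IH|U IH|i] n /=.
- move=> clUs; congr TChan.
  by elim: Us IH clUs => //= U Us IHs [IHU /IHs{}IHs] /andP[/IHU-> /IHs->].
- by move=> /IH->.
- by move=> lt_in; rewrite ltn_eqF // ltnNge ltnW.
Qed.

Lemma closed_ty_subst (n : nat) (V U : ty) :
  closed_at 0 V -> closed_at n.+1 U -> closed_at n (ty_subst n V U).
Proof.
move=> clV; elim/ty_nested_ind: U n => [Us a IH|U IH|i] n /=.
- by elim: Us IH => //= U Us IHs [IHU /IHs{}IHs] /andP[/IHU-> /IHs->].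
- exact: IH.
- case: eqVneq => [_ _|ne_in lt_in] /=; first exact: closed_at_leq clV.
  by case: ifP; lia.
Qed.

Lemma guarded_ty_subst (k m : nat) (V U : ty) :
  closed_at 0 V -> k < m -> guarded k U -> guarded k (ty_subst m V U).
Proof.
move=> clV; elim/ty_nested_ind: U k m => [//|U IH|i] k m /= lt_km; first exact: IH.
case: (eqVneq i m) => [_ _|ne_im ne_ik] /=; first exact: closed_at_guarded clV (leq0n _).
by case: ifP; lia.
Qed.

Lemma contractive_ty_subst (n : nat) (V U : ty) :
  closed_at 0 V -> contractive V -> contractive U ->
  contractive (ty_subst n V U).
Proof.
move=> clV ctV; elim/ty_nested_ind: U n => [Us a IH|U IH|i] n /=.
- by elim: Us IH => //= U Us IHs [IHU /IHs{}IHs] /andP[/IHU-> /IHs->].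
- by case/andP=> gU /IH->; rewrite guarded_ty_subst.
- by case: eqP.
Qed.

Fixpoint mu_depth (U : ty) : nat := if U is TMu V then (mu_depth V).+1 else 0.

(* The default [Aff] is only reached on open types. *)
Fixpoint head_attr (U : ty) : attr :=
  match U with TChan _ a => a | TMu V => head_attr V | TVar _ => Aff end.

Lemma mu_depth_ty_subst (n : nat) (V U : ty) :
  guarded n U -> mu_depth (ty_subst n V U) = mu_depth U.
Proof.
elim/ty_nested_ind: U n => [//|U IH|i] n /=; first by move=> /IH->.
by move/negPf->.
Qed.

Lemma head_attr_ty_subst (n : nat) (V U : ty) :
  guarded n U -> head_attr (ty_subst n V U) = head_attr U.
Proof.
elim/ty_nested_ind: U n => [//|U IH|i] n /=; first by move=> /IH->.
by move/negPf->.
Qed.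

Definition proper_ty (U : ty) : bool := closed_at 0 U && contractive U.

Lemma proper_unfold (U : ty) :
  proper_ty (TMu U) -> proper_ty (ty_subst 0 (TMu U) U) && guarded 0 U.
Proof.
case/andP=> clU /[dup] ctU /= /andP[gU ctU'].
by rewrite gU andbT /proper_ty closed_ty_subst //= contractive_ty_subst.
Qed.

(** Structural induction fails, since unfolding substitutes the type into itself. The number of
    leading [TMu] works: a guarded variable is not at the head, so each unfolding removes exactly
    one leading binder and leaves the head attribute alone. *)
Lemma proper_unfolds_to (U : ty) : proper_ty U ->
  exists Us, unfolds_to U Us (head_attr U) /\ all proper_ty Us.
Proof.
move: {-1}(mu_depth U) (erefl (mu_depth U)) => m.
elim: m U => [|m IH] [Us a|U|i] depU prU //.
- exists Us; split; first exact: unfolds_chan.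
  by case/andP: prU => /= /allP clU /allP ctU; apply/allP=> V VUs;
    rewrite /proper_ty clU ?ctU.
- case/andP: (proper_unfold prU) => prU' gU.
  have depU' : mu_depth (ty_subst 0 (TMu U) U) = m.
    by rewrite mu_depth_ty_subst //; case: depU.
  have [Us [unfU prUs]] := IH _ depU' prU'.
  exists Us; split=> //; apply: unfolds_mu.
  by rewrite head_attr_ty_subst in unfU.
Qed.

Lemma unfolds_to_inj (U : ty) Us a Vs b :
  unfolds_to U Us a -> unfolds_to U Vs b -> Us = Vs /\ a = b.
Proof.
move=> unfU; elim: unfU Vs b => {U Us a} [Us a|U Us a _ IH] Vs b unfV.
  by inversion unfV; subst.
by inversion unfV; subst; apply: IH.
Qed.

Lemma unfolds_to_head (U : ty) Us a : proper_ty U -> unfolds_to U Us a -> a = head_attr U.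
Proof.
by move=> /proper_unfolds_to[Vs [unfV _]] unfU; case: (unfolds_to_inj unfU unfV).
Qed.

(** [ty_eq] restated on raw types, because the components of an unfolding come without a proof of
    closedness and contractivity. *)
Definition ty_equiv (U V : ty) : Prop :=
  exists R : ty -> ty -> Prop, ty_bisimulation R /\ R U V.

Lemma ty_equiv_refl (U : ty) : proper_ty U -> ty_equiv U U.
Proof.
move=> prU; exists (fun V W => V = W /\ proper_ty V); split=> //.
move=> V _ [<- /proper_unfolds_to[Us [unfV prUs]]].
exists Us, Us, (head_attr V); split=> //.
by elim: Us prUs {unfV} => [|W Us IH] //= /andP[prW /IH]; constructor.
Qed.

Lemma ty_equiv_sym (U V : ty) : ty_equiv U V -> ty_equiv V U.
Proof.
case=> R [bisR RUV]; exists (fun V W => R W V); split=> // V' U' /bisR.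
move=> [Us [Vs [a [unfU unfV RUs]]]]; exists Vs, Us, a; split=> //.
by elim: RUs => *; constructor.
Qed.

Lemma Forall2_comp (A B C : Type) (R : A -> B -> Prop) (S : B -> C -> Prop) r s t :
  List.Forall2 R r s -> List.Forall2 S s t ->
  List.Forall2 (fun x z => exists2 y, R x y & S y z) r t.
Proof.
move=> Rrs; elim: Rrs t => [|x y r' s' Rxy _ IH] t St; inversion St; subst.
  by constructor.
by constructor; [exists y | apply: IH].
Qed.

Lemma Forall2_sub (A B : Type) (R S : A -> B -> Prop) r s :
  (forall x y, R x y -> S x y) -> List.Forall2 R r s -> List.Forall2 S r s.
Proof. by move=> sRS; elim=> *; constructor; auto. Qed.

Lemma ty_equiv_trans (U V W : ty) : ty_equiv U V -> ty_equiv V W -> ty_equiv U W.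
Proof.
case=> R [bisR RUV] [S [bisS SVW]].
exists (fun U W => exists2 V, R U V & S V W); split; last by exists V.
move=> U' W' [V' /bisR[Us [Vs [a [unfU unfV RUs]]]] /bisS[Vs' [Ws [b [unfV' unfW SVs]]]]].
have [eqVs eqab] := unfolds_to_inj unfV unfV'; subst Vs' b.
by exists Us, Ws, a; split=> //; apply: Forall2_comp RUs SVs.
Qed.

Lemma ty_equiv_head (U V : ty) :
  proper_ty U -> proper_ty V -> ty_equiv U V -> head_attr U = head_attr V.
Proof.
move=> prU prV [R [bisR /bisR[Us [Vs [a [unfU unfV _]]]]]].
by rewrite -(unfolds_to_head prU unfU) (unfolds_to_head prV unfV).
Qed.

Lemma ty_equiv_unfold (U V : ty) : ty_equiv U V ->
  exists Us Vs a, [/\ unfolds_to U Us a, unfolds_to V Vs a & List.Forall2 ty_equiv Us Vs].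
Proof.
case=> R [bisR /[dup] RUV /bisR[Us [Vs [a [unfU unfV RUs]]]]].
exists Us, Vs, a; split=> //.
by apply: Forall2_sub RUs => U' V' RUV'; exists R.
Qed.

(** Attributes are ignored, since splitting, joining and subtyping change nothing else. Payloads are
    compared after unfolding, since [str_eq] may replace a channel type by a recursive one. *)
Definition same_payload (T1 T2 : typ) : Prop :=
  match T1, T2 with
  | TyProc, TyProc => True
  | TyCh U, TyCh V => exists Us Vs a b,
      [/\ unfolds_to U Us a, unfolds_to V Vs b & List.Forall2 ty_equiv Us Vs]
  | _, _ => False
  end.

Lemma Forall2_ty_equiv_refl (Us : seq ty) : all proper_ty Us -> List.Forall2 ty_equiv Us Us.
Proof.
by elim: Us => //= U Us IH /andP[/ty_equiv_refl UU /IH]; constructor.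
Qed.

Lemma same_payload_refl (T : typ) : same_payload T T.
Proof.
case: T => //= U; have [Us [unfU prUs]] := proper_unfolds_to (chtyP U).
by exists Us, Us, (head_attr U), (head_attr U); split=> //; apply: Forall2_ty_equiv_refl.
Qed.

Lemma same_payload_sym (T1 T2 : typ) : same_payload T1 T2 -> same_payload T2 T1.
Proof.
case: T1 T2 => [U|] [V|] //= [Us [Vs [a [b [unfU unfV eqUs]]]]].
exists Vs, Us, b, a; split=> //.
by elim: eqUs => *; constructor; first exact: ty_equiv_sym.
Qed.

Lemma same_payload_trans (T1 T2 T3 : typ) :
  same_payload T1 T2 -> same_payload T2 T3 -> same_payload T1 T3.
Proof.
case: T1 T2 T3 => [U|] [V|] [W|] //=.
move=> [Us [Vs [a [b [unfU unfV eqUs]]]]] [Vs' [Ws [b' [c [unfV' unfW eqVs]]]]].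
have [eq1 _] := unfolds_to_inj unfV unfV'; subst Vs'.
exists Us, Ws, a, c; split=> //; apply: Forall2_sub (Forall2_comp eqUs eqVs).
by move=> ? ? [?]; apply: ty_equiv_trans.
Qed.

Lemma same_payload_chan (Us : seq chty) (a b : attr) : same_payload [Us]^a [Us]^b.
Proof.
exists (map ty_of_chty Us), (map ty_of_chty Us), a, b; split; try exact: unfolds_chan.
by apply: Forall2_ty_equiv_refl; apply/allP=> _ /mapP[U _ ->]; apply: chtyP.
Qed.

Lemma same_payload_eq (U V : chty) : U ∼ V -> same_payload U V.
Proof.
by move=> /ty_equiv_unfold[Us [Vs [a [unfU unfV eqUs]]]]; exists Us, Vs, a, a.
Qed.

Lemma same_payload_chanE (Us Vs : seq chty) (a b : attr) :
  same_payload [Us]^a [Vs]^b -> List.Forall2 ty_eq Us Vs.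
Proof.
case=> [Us' [Vs' [a' [b' [unfU unfV eqUs]]]]].
have [eq1 _] := unfolds_to_inj unfU (unfolds_chan _ _); subst Us'.
have [eq1 _] := unfolds_to_inj unfV (unfolds_chan _ _); subst Vs'.
elim: Us Vs eqUs {unfU unfV} => [|U Us IH] [|V Vs] /= eqUs; inversion eqUs; subst;
  by constructor; auto.
Qed.

Lemma T_rec_unfold (T : chty) : T_rec T ∼ [[:: T; T_rec T]]^(Uni 1).
Proof.
(* One unfolding of [T_rec T] gives the right-hand side itself, so this single pair added to the
   identity is already a bisimulation. *)
pose R (U V : ty) := (U = V /\ proper_ty U) \/
  (U = T_rec T /\ V = [[:: T; T_rec T]]^(Uni 1)).
exists R; split; last by right.
have prT := chtyP T; have prTr := chtyP (T_rec T).
move=> U V [[<- /proper_unfolds_to[Us [unfU prUs]]]|[-> ->]].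
  exists Us, Us, (head_attr U); split=> //.
  by elim: Us prUs {unfU} => [|W Us IH] //= /andP[prW /IH]; constructor=> //; left.
exists [:: ty_of_chty T; ty_of_chty (T_rec T)], [:: ty_of_chty T; ty_of_chty (T_rec T)], (Uni 1).
split; [|exact: unfolds_chan|by do! constructor].
apply: unfolds_mu => /=; rewrite ty_subst_closed; last by case/andP: prT.
exact: unfolds_chan.
Qed.

(** * Consistency of environments *)

Lemma enum_msetD (K : choiceType) (A B : {mset K}) :
  perm_eq (enum_mset (A `+` B)) (enum_mset A ++ enum_mset B).
Proof.
by apply/allP=> a _ /=; rewrite count_cat !count_mem_mset !msetE2.
Qed.

Lemma enum_mset1 (K : choiceType) (a : K) : enum_mset [mset a] = [:: a].
Proof. exact: enum_msetn. Qed.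

Lemma seq_mset_cat (K : choiceType) (s t : seq K) :
  seq_mset (s ++ t) = seq_mset s `+` seq_mset t.
Proof. by apply/msetP=> a; rewrite msetE2 !mset_seqE count_cat. Qed.

Lemma seq_mset_perm (K : choiceType) (s t : seq K) : perm_eq s t -> seq_mset s = seq_mset t.
Proof. by move=> ?; apply/eq_seq_msetP. Qed.

Lemma seq_mset1 (K : choiceType) (a : K) : seq_mset [:: a] = [mset a].
Proof. by apply/msetP=> b; rewrite mset_seqE msetnE /= addn0 eq_sym; case: eqP. Qed.

Lemma seq_mset0 (K : choiceType) : seq_mset [::] = mset0 :> {mset K}.
Proof. by apply/msetP=> b; rewrite mset_seqE mset0E. Qed.

Lemma seq_mset_cons u U (s : seq (ident * typ)) :
  seq_mset ((u, U) :: s) = u :- U `+` seq_mset s.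
Proof. by rewrite -cat1s seq_mset_cat seq_mset1. Qed.

Lemma msetDE (K : choiceType) (A B : {mset K}) a : (A `+` B) a = A a + B a.
Proof. by rewrite msetE2. Qed.

(* Atoms are generalized first: [lia] is slow on the types they contain. *)
Ltac mset_ac :=
  repeat match goal with
  | |- context [assume ?u ?T] => move: (assume u T) => ?
  | |- context [binds ?us ?Us] => move: (binds us Us) => ?
  end;
  apply/msetP=> ?; rewrite !msetDE; lia.

Lemma struct_le_add (G G' H : env) : G ≺ G' -> G `+` H ≺ G' `+` H.
Proof.
have swap (A B : env) : A `+` B `+` H = A `+` H `+` B by rewrite msetDAC.
elim=> {G G'}.
- by move=> G; apply: str_refl.
- by move=> G1 G2 G3 _ H1 _ H2; apply: str_trans H1 H2.
- move=> G u T T1 T2 sT; rewrite !swap; exact: str_split.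
- move=> G u T T1 T2 sT; rewrite !swap; exact: str_join.
- move=> G u U1 U2 e; rewrite !swap; exact: str_eq.
- move=> G u Us a1 a2 s; rewrite !swap; exact: str_sub.
- move=> G u T; rewrite !swap; exact: str_weak.
- move=> G u Us1 Us2; rewrite !swap; exact: str_rev.
Qed.

Lemma struct_le_weak (G H : env) : G `+` H ≺ G.
Proof.
rewrite -[H]seq_mset_id; elim: (enum_mset H) => [|[u T] s IH].
  by rewrite seq_mset0 msetD0; apply: str_refl.
rewrite seq_mset_cons (msetDC (_ :- _)) msetDA; exact: str_trans (str_weak _ _ _) IH.
Qed.

Lemma consistent_struct (G G' : env) : consistent G -> G ≺ G' -> consistent G'.
Proof. by case=> H [fH leH] le; exists H; split=> //; apply: str_trans leH le. Qed.

Lemma consistent_seq (s : seq (ident * typ)) :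
  uniq [seq p.1 | p <- s] -> consistent (seq_mset s).
Proof.
move=> us; exists (seq_mset s); split; last exact: str_refl.
by rewrite /functional (perm_uniq (perm_map _ (perm_eq_seq_mset _))).
Qed.

(** A partial renaming: identifiers sent to [None] lose their assumptions. It serves both to
    restrict an environment and to apply a bijection of channels. *)
Definition env_pmap (f : ident -> option ident) (G : env) : env :=
  seq_mset (pmap (fun p => omap (fun u => (u, p.2)) (f p.1)) (enum_mset G)).

Lemma env_pmapD f (G H : env) : env_pmap f (G `+` H) = env_pmap f G `+` env_pmap f H.
Proof.
rewrite /env_pmap -seq_mset_cat -pmap_cat; apply: seq_mset_perm.
exact: perm_pmap (enum_msetD _ _).
Qed.

Lemma env_pmap1 f u T :
  env_pmap f (u :- T) = if f u is Some v then v :- T else mset0.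
Proof.
rewrite /env_pmap enum_mset1 /=.
by case: (f u) => [v|] /=; rewrite ?seq_mset1 ?seq_mset0.
Qed.

Lemma env_pmap_id f (G : env) : (forall u, dom G u -> f u = Some u) -> env_pmap f G = G.
Proof.
move=> fE; rewrite -[RHS]seq_mset_id /env_pmap; congr seq_mset.
have: forall u T, (u, T) \in enum_mset G -> f u = Some u.
  by move=> u T uTG; apply: fE; exists T.
elim: (enum_mset G) => //= [[u T] s] IH H /=.
rewrite (H u T) ?mem_head //= IH // => v T' vs; apply: (H v T').
by rewrite inE vs orbT.
Qed.

Lemma env_pmap_struct f (G G' : env) : G ≺ G' -> env_pmap f G ≺ env_pmap f G'.
Proof.
elim=> {G G'}; first by move=> *; apply: str_refl.
- by move=> G1 G2 G3 _ H1 _ H2; apply: str_trans H1 H2.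
- move=> G u T T1 T2 sT; rewrite !env_pmapD !env_pmap1; case: (f u) => [v|].
    exact: str_split.
  by rewrite !msetD0; apply: str_refl.
- move=> G u T T1 T2 sT; rewrite !env_pmapD !env_pmap1; case: (f u) => [v|].
    exact: str_join.
  by rewrite !msetD0; apply: str_refl.
- move=> G u U1 U2 e; rewrite !env_pmapD !env_pmap1; case: (f u) => [v|].
    exact: str_eq.
  by rewrite !msetD0; apply: str_refl.
- move=> G u Us a1 a2 s; rewrite !env_pmapD !env_pmap1; case: (f u) => [v|].
    exact: str_sub.
  by rewrite !msetD0; apply: str_refl.
- move=> G u T; rewrite !env_pmapD !env_pmap1; case: (f u) => [v|].
    exact: str_weak.
  by rewrite !msetD0; apply: str_refl.
- move=> G u Us1 Us2; rewrite !env_pmapD !env_pmap1; case: (f u) => [v|].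
    exact: str_rev.
  by rewrite !msetD0; apply: str_refl.
Qed.

Lemma env_pmap_functional f (G : env) :
  (forall u v u', f u = Some u' -> f v = Some u' -> u = v) ->
  functional G -> functional (env_pmap f G).
Proof.
rewrite /functional => fI fG.
rewrite (perm_uniq (perm_map _ (perm_eq_seq_mset _))).
elim: (enum_mset G) fG => //= [[u T] s] IH /andP[us /IH{}IH] /=.
case fu: (f u) => [v|] //=; rewrite IH andbT.
apply: contraNN us => /mapP[[v' T'] /= vs ev]; rewrite {v}ev in fu.
move: vs; rewrite mem_pmap => /mapP[[u' T''] us /=].
case fu': (f u') => [w|] //= [ew _]; subst w.
by apply/mapP; exists (u', T'') => //=; apply: fI fu fu'.
Qed.

Lemma consistent_pmap f (G : env) :
  (forall u v u', f u = Some u' -> f v = Some u' -> u = v) ->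
  consistent G -> consistent (env_pmap f G).
Proof.
move=> fI [H [fH leH]]; exists (env_pmap f H); split.
  exact: env_pmap_functional.
exact: env_pmap_struct.
Qed.

Lemma dom_add (G H : env) u : dom (G `+` H) u <-> dom G u \/ dom H u.
Proof.
split=> [[T]|[[T uG]|[T uH]]].
- by rewrite in_msetD => /orP[]; [left|right]; exists T.
- by exists T; rewrite in_msetD uG.
- by exists T; rewrite in_msetD uH orbT.
Qed.

Lemma dom1 u T v : dom (u :- T) v <-> v = u.
Proof.
split=> [[T']|->]; first by rewrite in_mset1 => /eqP[].
by exists T; rewrite in_mset1.
Qed.

Lemma dom0 u : ~ dom mset0 u.
Proof. by case=> T; rewrite in_mset0. Qed.

(* A fresh identifier may already occur in the functional witness of
   consistency, so the witness is first restricted to the other identifiers. *)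
Lemma consistent_fresh (G : env) u T : consistent G -> ~ dom G u -> consistent (G `+` u :- T).
Proof.
move=> cG nGu; pose f v := if v == u then None else Some v.
have fI v v' u' : f v = Some u' -> f v' = Some u' -> v = v'.
  by rewrite /f; case: eqP => // _ [->]; case: eqP => // _ [].
have fG : env_pmap f G = G.
  by apply: env_pmap_id => v; rewrite /f; case: eqP => // ->.
case: cG => H [fH leH].
exists (env_pmap f H `+` u :- T); split; last first.
  by rewrite -fG; apply/struct_le_add/env_pmap_struct.
have := env_pmap_functional fI fH; rewrite /functional => fH'.
rewrite (perm_uniq (perm_map _ (enum_msetD _ _))) map_cat cat_uniq fH' enum_mset1 /= andbT orbF.
apply/mapP=> -[[v T'] /=]; rewrite (perm_mem (perm_eq_seq_mset _)) mem_pmap.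
case/mapP=> -[v' T''] _ /=; rewrite /f; case: eqP => //= nv [-> _] eu.
by rewrite eu in nv.
Qed.

(** * Types that a consistent environment can assign to one identifier *)

Definition types_at (u : ident) (G : env) : seq typ :=
  [seq p.2 | p <- enum_mset G & p.1 == u].

Lemma types_atD u (G H : env) :
  perm_eq (types_at u (G `+` H)) (types_at u G ++ types_at u H).
Proof. by rewrite /types_at -map_cat -filter_cat; apply/perm_map/perm_filter/enum_msetD. Qed.

Lemma types_at1 u v T : types_at u (v :- T) = if v == u then [:: T] else [::].
Proof. by rewrite /types_at enum_mset1 /=; case: ifP. Qed.

Lemma mem_types_at u T (G : env) : ((u, T) \in G) = (T \in types_at u G).
Proof.
apply/idP/mapP => [uTG|[[v T'] /=]]; first by exists (u, T); rewrite // mem_filter eqxx.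
by rewrite mem_filter /= => /andP[/eqP-> vG] ->.
Qed.

Definition typ_attr (T : typ) : attr := if T is TyCh U then head_attr U else Unr.

(* The assumptions obtainable by splitting a single one: a unique [Uni i]
   coexists with at most [i] further assumptions, all of them affine. *)
Definition attrs_ok (s : seq attr) : Prop :=
  forall i, Uni i \in s -> size s <= i.+1 /\ count (predC1 Aff) s <= 1.

(** The invariant of [≺] that replaces inversion of consistency. It holds trivially of a list with
    at most one element, hence of every functional environment. *)
Definition types_ok (s : seq typ) : Prop :=
  (forall T1 T2, T1 \in s -> T2 \in s -> same_payload T1 T2)
  /\ attrs_ok (map typ_attr s).

Lemma types_ok_perm s t : perm_eq s t -> types_ok s -> types_ok t.
Proof.
move=> pst [ps as_]; split=> [T1 T2|i]; first by rewrite -!(perm_mem pst); apply: ps.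
have pat := perm_map typ_attr pst.
by rewrite -(perm_mem pat) -(perm_size pat) -(permP pat); apply: as_.
Qed.

Lemma types_ok_cons_sub s T T' : same_payload T T' ->
  (attrs_ok (map typ_attr (T :: s)) -> attrs_ok (map typ_attr (T' :: s))) ->
  types_ok (T :: s) -> types_ok (T' :: s).
Proof.
move=> TT' aT [ps as_]; split; last exact: aT.
have pT T1 : T1 \in T' :: s -> same_payload T T1.
  by rewrite inE => /orP[/eqP->//|Ts]; apply: ps; rewrite !inE ?eqxx // Ts orbT.
by move=> T1 T2 /pT p1 /pT p2; apply: same_payload_trans (same_payload_sym p1) p2.
Qed.

Lemma types_ok_tail s T : types_ok (T :: s) -> types_ok s.
Proof.
move=> [ps as_]; split=> [T1 T2 s1 s2|i si].
  by apply: ps; rewrite inE ?s1 ?s2 orbT.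
have [] := as_ i; first by rewrite inE si orbT.
by move=> /=; lia.
Qed.

Lemma types_ok_dup s T T' : same_payload T T' ->
  (attrs_ok (map typ_attr (T :: s)) -> attrs_ok (map typ_attr (T' :: T :: s))) ->
  types_ok (T :: s) -> types_ok (T' :: T :: s).
Proof.
move=> TT' aT [ps as_]; split; last exact: aT.
have pT T1 : T1 \in T' :: T :: s -> same_payload T T1.
  by rewrite inE => /orP[/eqP->//|Ts]; apply: ps; rewrite // mem_head.
by move=> T1 T2 /pT p1 /pT p2; apply: same_payload_trans (same_payload_sym p1) p2.
Qed.

Lemma attrs_ok_uni i s : attrs_ok (Uni i :: s) ->
  size s <= i /\ forall a, a \in s -> a = Aff.
Proof.
move=> /(_ i); rewrite mem_head => /(_ isT)[szs cs]; split=> // a sa.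
have {}cs : 1 + count (predC1 Aff) s <= 1 := cs.
apply/eqP; apply: contraT => na.
have : 0 < count (predC1 Aff) s by rewrite -has_count; apply/hasP; exists a.
by lia.
Qed.

Lemma attrs_ok_unr i s : attrs_ok (Unr :: s) -> Uni i \notin s.
Proof.
move=> ok; apply/negP=> si; have [|_ cs] := ok i; first by rewrite inE si orbT.
have {}cs : 1 + count (predC1 Aff) s <= 1 := cs.
have : 0 < count (predC1 Aff) s by rewrite -has_count; apply/hasP; exists (Uni i).
by lia.
Qed.

Lemma attrs_ok_noUni s : (forall i, Uni i \notin s) -> attrs_ok s.
Proof. by move=> no i si; case/negP: (no i). Qed.

Lemma attrs_ok_sub a b s : sub_attr a b -> attrs_ok (a :: s) -> attrs_ok (b :: s).
Proof.
move=> sab; elim: sab s => {a b} [//|a b c _ H1 _ H2|i|i|] s.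
- by move=> /H1/H2.
- move=> /attrs_ok_uni[szs affs] j; rewrite inE => /orP[/eqP[->]|/affs//] /=.
  split; first lia.
  by rewrite (@eq_in_count _ _ pred0) ?count_pred0 // => a /affs->.
- move=> /attrs_ok_uni[szs affs]; apply: attrs_ok_noUni => j.
  by rewrite inE /=; apply/negP=> /affs.
- move=> ok; apply: attrs_ok_noUni => j; rewrite inE /=; exact: attrs_ok_unr ok.
Qed.

Lemma types_ok_at u v T (G : env) :
  types_ok (types_at u (G `+` v :- T)) <->
  types_ok (if v == u then T :: types_at u G else types_at u G).
Proof.
have p : perm_eq (types_at u (G `+` v :- T))
           (if v == u then T :: types_at u G else types_at u G).
  rewrite (permPl (types_atD _ _ _)) types_at1; case: eqP; rewrite ?cats0 // cats1.
  by rewrite perm_rcons.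
by split; apply: types_ok_perm; rewrite // perm_sym.
Qed.

Lemma types_ok_at2 u v T1 T2 (G : env) :
  types_ok (types_at u (G `+` v :- T1 `+` v :- T2)) <->
  types_ok (if v == u then T1 :: T2 :: types_at u G else types_at u G).
Proof.
have p : perm_eq (types_at u (G `+` v :- T1 `+` v :- T2))
           (if v == u then T1 :: T2 :: types_at u G else types_at u G).
  rewrite -msetDA (permPl (types_atD _ _ _)).
  rewrite perm_catC (permPl (perm_cat (types_atD _ _ _) (perm_refl _))).
  by rewrite !types_at1; case: eqP.
by split; apply: types_ok_perm; rewrite // perm_sym.
Qed.

(** Splitting [Uni i] lengthens the list by one and raises the permitted length by one; joining does
    the reverse. [str_rev] changes a payload, but only at [Uni 0], which tolerates no other
    assumption with which it could disagree. *)
Lemma types_ok_struct u (G G' : env) : G ≺ G' ->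
  types_ok (types_at u G) -> types_ok (types_at u G').
Proof.
elim=> {G G'}; first by move=> G; exact id.
  by move=> G1 G2 G3 _ H1 _ H2 /H1/H2.
all: move=> G v.
- move=> T T1 T2 sT /types_ok_at H; apply/types_ok_at2; case: (v == u) H => //.
  case: sT => [Us||Us i]; try (apply: types_ok_dup; first exact: same_payload_refl).
  + by move=> /attrs_ok_unr ok; apply: attrs_ok_noUni => i; rewrite !inE; apply: ok.
  + by move=> /attrs_ok_unr ok; apply: attrs_ok_noUni => i; rewrite !inE; apply: ok.
  + move=> /[dup] -[_ /attrs_ok_uni[szs affs]] ok.
    have affs0 : count (predC1 Aff) (map typ_attr (types_at u G)) = 0.
      by rewrite (@eq_in_count _ _ pred0) ?count_pred0 // => a /affs->.
    (* The split is decomposed into subtyping from [Uni i] to [Uni i.+1] followed by the addition of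
       the affine half. *)
    have {ok} : types_ok (TyCh [Us]^(Uni i.+1) :: types_at u G).
      apply: types_ok_cons_sub ok; first exact: same_payload_chan.
      by apply: attrs_ok_sub; apply: sub_uni.
    apply: types_ok_dup; first exact: same_payload_chan.
    move=> _ j; rewrite !inE => /orP[//|/orP[/eqP[->]|/affs//]] /=.
    by rewrite affs0; split=> //; lia.
- move=> T T1 T2 sT /types_ok_at2 H; apply/types_ok_at; case: (v == u) H => //.
  case: sT => [Us||Us i]; try exact: types_ok_tail.
  (* Dropping the affine half loses one unit of the length bound, so the bound for [Uni i] is taken
     from the full list at [Uni i.+1]. *)
  move=> /[dup] -[_ as_] /types_ok_tail; apply: types_ok_cons_sub.
    exact: same_payload_chan.
  move=> /attrs_ok_uni[_ affs] j; rewrite inE => /orP[/eqP[->]|/affs//].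
  have [|szs cs] := as_ i.+1; first by rewrite !inE eqxx orbT.
  by split.
- move=> U1 U2 eU /types_ok_at H; apply/types_ok_at; case: (v == u) H => //.
  apply: types_ok_cons_sub; first exact: same_payload_eq.
  by rewrite /= (ty_equiv_head _ _ eU) //; apply: chtyP.
- move=> Us a1 a2 sa /types_ok_at H; apply/types_ok_at; case: (v == u) H => //.
  by apply: types_ok_cons_sub; [exact: same_payload_chan | exact: attrs_ok_sub].
- by move=> T /types_ok_at; case: (v == u) => // /types_ok_tail.
- move=> Us1 Us2 /types_ok_at H; apply/types_ok_at; case: (v == u) H => //.
  move: (types_at u G) => s [_ /attrs_ok_uni[]]; rewrite size_map leqn0 => /nilP-> _; split.
    by move=> T1 T2; rewrite !inE => /eqP-> /eqP->; apply: same_payload_refl.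
  by move=> i; rewrite inE => /eqP[->].
Qed.

Lemma consistent_types_ok u (G : env) : consistent G -> types_ok (types_at u G).
Proof.
case=> H [fH /(@types_ok_struct u)]; apply.
have : size (types_at u H) <= 1.
  rewrite /types_at size_map size_filter.
  rewrite (_ : count _ _ = count_mem u [seq p.1 | p <- enum_mset H]); last by rewrite count_map.
  by rewrite count_uniq_mem //; case: (_ \in _).
case: (types_at u H) => [|T [|//]] _; first by split.
split=> [T1 T2|i]; first by rewrite !inE => /eqP-> /eqP->; apply: same_payload_refl.
by move=> _ /=; split=> //; case: (_ != _).
Qed.

Lemma consistent_pair (G : env) u T1 T2 : consistent (G `+` u :- T1 `+` u :- T2) ->
  same_payload T1 T2 /\ attrs_ok (typ_attr T1 :: typ_attr T2 :: map typ_attr (types_at u G)).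
Proof.
move=> /(@consistent_types_ok u)/types_ok_at2; rewrite eqxx => -[ps as_]; split=> //.
by apply: ps; rewrite !inE eqxx ?orbT.
Qed.

Lemma consistent_unique (G : env) u Us : consistent (G `+` u :- [Us]^(Uni 0)) -> ~ dom G u.
Proof.
move=> /(@consistent_types_ok u)/types_ok_at; rewrite eqxx => -[_ /attrs_ok_uni[sG _]].
by case=> T; rewrite mem_types_at; case: (types_at u G) sG.
Qed.

Lemma consistent_uni_aff (G : env) u U Us Vs a :
  head_attr (ty_of_chty U) = Uni 1 -> same_payload U [Vs]^(Uni 1) ->
  consistent (G `+` u :- [Us]^a `+` u :- U) ->
  a = Aff /\ List.Forall2 ty_eq Us Vs.
Proof.
move=> hU pU /consistent_pair[pUs aU]; split; last first.
  exact: same_payload_chanE (same_payload_trans pUs pU).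
have : attrs_ok (Uni 1 :: a :: map typ_attr (types_at u G)).
  by move=> i; have := aU i; rewrite /= hU !inE orbCA /= addnCA.
by case/attrs_ok_uni=> _; apply; rewrite mem_head.
Qed.

(** Used for [out], which the process holds at [Unr]: a unique assumption of the observer would
    tolerate only affine partners. *)
Lemma consistent_unr (G : env) u Us Vs a :
  consistent (G `+` u :- [Us]^a `+` u :- [Vs]^Unr) ->
  (a = Aff \/ a = Unr) /\ List.Forall2 ty_eq Us Vs.
Proof.
move=> /consistent_pair[/same_payload_chanE pUs aU]; split=> //.
case: a aU => [||i] aU; [by right|by left|].
by case/attrs_ok_uni: aU => _ /(_ Unr); rewrite mem_head => /(_ isT).
Qed.

(** * Renaming and transitions *)

Lemma resource_env_sub (M N : set chan) :
  (forall c, M c -> N c) -> resource_env N -> resource_env M.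
Proof. by move=> sMN infN finM; apply/infN/(sub_finite_set _ finM) => c nNc /sMN. Qed.

Lemma resource_env_add (M : set chan) c : resource_env M -> resource_env (c |` M)%classic.
Proof.
move=> infM finM; apply: infM.
have fin : finite_set ([set c] `|` ~` (c |` M))%classic.
  by rewrite finite_setU; split; first exact: finite_set1.
apply: sub_finite_set fin => e nMe /=.
by have [->|/eqP nec] := eqVneq e c; [left | right=> -[]].
Qed.

Lemma resource_env_image (s : chan -> chan) (M : set chan) :
  bijective s -> resource_env M -> resource_env (s @` M)%classic.
Proof.
move=> [t sK tK] infM finM; apply: infM.
apply: sub_finite_set (finite_image t finM) => c nMc /=.
by exists (s c) => //= -[e Me /(can_inj sK) eec]; rewrite eec in Me.
Qed.

Lemma resource_env_fresh (M : set chan) : resource_env M -> exists c, ~ M c.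
Proof.
move=> infM; apply/not_existsP => fullM; apply: infM.
by rewrite (_ : ~` M = set0)%classic //; apply/seteqP; split=> // c /fullM.
Qed.

Definition swap (c e : chan) (i : chan) : chan :=
  if i == c then e else if i == e then c else i.

Lemma swapK c e : involutive (swap c e).
Proof.
rewrite /swap => i; have [->|nic] := eqVneq i c; first by rewrite eqxx; case: eqVneq.
by have [->|nie] := eqVneq i e; rewrite ?eqxx // (negPf nic) (negPf nie).
Qed.

Lemma swap_bij c e : bijective (swap c e).
Proof. exact: inv_bij (@swapK c e). Qed.

Lemma swap_id c e i : i <> c -> i <> e -> swap c e i = i.
Proof. by move=> /eqP/negPf nic /eqP/negPf nie; rewrite /swap nic nie. Qed.

Lemma rename_identM (s t : chan -> chan) u :
  rename_ident s (rename_ident t u) = rename_ident (s \o t) u.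
Proof. by case: u. Qed.

Lemma renameM (s t : chan -> chan) P : rename s (rename t P) = rename (s \o t) P.
Proof.
elim: P => //= [u vs P ->|u xs P ->|u v P -> Q ->|w P ->|P -> Q ->|x P ->|u P ->] //;
  rewrite ?rename_identM // -map_comp.
by congr Out; apply: eq_map => v /=; rewrite rename_identM.
Qed.

Lemma rename_identE (s : chan -> chan) u : s =1 id -> rename_ident s u = u.
Proof. by case: u => //= c ->. Qed.

Lemma rename_eqid (s : chan -> chan) P : s =1 id -> rename s P = P.
Proof.
move=> sE; elim: P => //= [u vs P ->|u xs P ->|u v P -> Q ->|w P ->|P -> Q ->|x P ->|u P ->] //;
  rewrite ?rename_identE //.
by congr Out; rewrite -[RHS]map_id; apply: eq_map => v; rewrite rename_identE.
Qed.

Lemma rename_systemM (s t : chan -> chan) S :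
  rename_system s (rename_system t S) = rename_system (s \o t) S.
Proof. by rewrite /rename_system /= renameM image_comp. Qed.

Lemma rename_system_eqid (s : chan -> chan) S : s =1 id -> rename_system s S = S.
Proof.
case: S => M P sE; rewrite /rename_system rename_eqid //=; congr pair.
by rewrite (_ : s = id) ?image_id //; apply: funext.
Qed.

Definition fixes (s : chan -> chan) (G : env) : Prop := forall c, dom G (Ch c) -> s c = c.

Lemma fixes_inv (s t : chan -> chan) (G : env) : cancel s t -> fixes s G -> fixes t G.
Proof. by move=> sK fs c Gc; rewrite -[in LHS](fs _ Gc) sK. Qed.

(** A transition starts with an arbitrary renaming that fixes the observer's channels, so one more
    such renaming is absorbed by composition. *)
Lemma step_rename (s : chan -> chan) (G : env) S mu k G' S' :
  bijective s -> fixes s G ->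
  step G (rename_system s S) mu k G' S' -> step G S mu k G' S'.
Proof.
move=> bs fs [t [bt ft]]; rewrite rename_systemM => st; exists (t \o s); split=> //.
  exact: bij_comp.
by move=> c Gc /=; rewrite fs // ft.
Qed.

Lemma tau_steps_rename (s : chan -> chan) (G : env) S k G' S' :
  bijective s -> fixes s G -> tau_steps G (rename_system s S) k G' S' ->
  exists S'', tau_steps G S k G' S'' /\
    (S'' = S' \/ [/\ G' = G, S'' = S & S' = rename_system s S]).
Proof.
move=> bs fs sts; inversion sts; subst; first by exists S; split; [constructor|right].
by exists S'; split; [apply: taus_step (step_rename bs fs H) H0|left].
Qed.

(* An empty weak transition cannot absorb the renaming, whence the second
   alternative. *)
Lemma weak_hat_rename (s : chan -> chan) (G : env) S mu k G' S' :
  bijective s -> fixes s G -> weak_hat G (rename_system s S) mu k G' S' ->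
  exists S'', weak_hat G S mu k G' S'' /\
    (S'' = S' \/ [/\ G' = G, S'' = S & S' = rename_system s S]).
Proof.
move=> bs fs; have wk : weak G (rename_system s S) mu k G' S' -> weak G S mu k G' S'.
  move=> [k1 [k2 [k3 [G1 [S1 [G2 [S2 [t1 st t2 ->]]]]]]]].
  have [S1' [t1' [e|[eG eS eS1]]]] := tau_steps_rename bs fs t1.
    by subst S1'; exists k1, k2, k3, G1, S1, G2, S2.
  subst G1 S1' S1; exists k1, k2, k3, G, S, G2, S2; split=> //.
  exact: step_rename st.
case: mu wk => [c ds|c ds|||c|] wk; rewrite /weak_hat;
  try by move=> /wk ?; exists S'; split; last left.
exact: tau_steps_rename.
Qed.

Lemma step_pre (G : env) S mu k G' S' : pre_step G S mu k G' S' -> step G S mu k G' S'.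
Proof.
by move=> st; exists id; split=> //; [exists id | rewrite rename_system_eqid].
Qed.

Lemma weak_step (G : env) S mu k G' S' : step G S mu k G' S' -> weak_hat G S mu k G' S'.
Proof.
move=> st; have wk : weak G S mu k G' S'.
  by exists 0%R, k, 0%R, G, S, G', S'; split; rewrite ?addr0 ?add0r //; constructor.
case: mu wk st => //= _ st; rewrite -[k]addr0; apply: taus_step st _; constructor.
Qed.

Lemma struct_le_dom (G G' : env) u : G ≺ G' -> dom G' u -> dom G u.
Proof.
elim=> {G G'}; [by move=> G; exact id | by move=> G1 G2 G3 _ H1 _ H2 /H2/H1 | ..].
all: by move=> G v; intros; rewrite -> !dom_add, ?dom1 in *; tauto.
Qed.

(** The moves of the observer, separated from the process that they leave unchanged; they can then
    be matched once for all stages. *)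
Inductive env_step : env -> set chan -> label -> int -> env -> set chan -> Prop :=
| es_env G G' M : G ≺ G' -> env_step G M LEnv 0 G' M
| es_alloc G (M : set chan) c Us : ~ M c ->
    env_step G M LAlloc 1 (G `+` Ch c :- [Us]^(Uni 0)) (c |` M)%classic
| es_free (G : env) (M : set chan) c Us : ~ M c ->
    env_step (G `+` Ch c :- [Us]^(Uni 0)) (c |` M)%classic (LFree c) (- 1)%R G M.

Definition env_label (mu : label) : bool :=
  match mu with LEnv | LAlloc | LFree _ => true | _ => false end.

Lemma pre_step_env (G : env) S mu k G' S' : pre_step G S mu k G' S' -> env_label mu ->
  S'.2 = S.2 /\ env_step G S.1 mu k G' S'.1.
Proof.
elim=> {G S mu k G' S'} //=; try by move=> *; split=> //; constructor.
- by move=> G G' M M' mu k P P' Q _ IH /IH[/= ->].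
- by move=> G G' M M' mu k P P' Q _ IH /IH[/= ->].
Qed.

(** Each communication on [d] leaves the [PNil] that follows the output in parallel with the
    back-end. There is no structural congruence to remove it, so the copies accumulate, one per
    round. *)
Definition pad (n : nat) (P : proc) : proc := iter n (fun Q => Par Q PNil) P.

Lemma rename_pad s n P : rename s (pad n P) = pad n (rename s P).
Proof. by elim: n => //= n ->. Qed.

Lemma pad_step n (G : env) M mu k G' M' P P' :
  pre_step G (M, P) mu k G' (M', P') -> pre_step G (M, pad n P) mu k G' (M', pad n P').
Proof. by move=> st; elim: n => //= n; apply: s_par_l. Qed.

(** * Inversion of the transitions of the individual stages *)

Lemma nil_step (G : env) M mu k G' S' : pre_step G (M, PNil) mu k G' S' -> env_label mu.
Proof. by move=> st; inversion st; subst. Qed.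

(** Moves of the observer are set aside because the derivation may attribute them to a [PNil]
    component; any other step must come from [P], since [PNil] neither sends nor receives. *)
Lemma pad_step_inv n (G : env) M mu k G' M' P Q' :
  pre_step G (M, pad n P) mu k G' (M', Q') -> ~~ env_label mu ->
  exists2 P', Q' = pad n P' & pre_step G (M, P) mu k G' (M', P').
Proof.
elim: n mu k G' M' Q' => [|n IH] mu k G' M' Q' /= st nmu; first by exists Q'.
inversion st; subst=> //; try match goal with
  H : pre_step _ (_, PNil) _ _ _ _ |- _ => by move/nil_step: H nmu => //= -> end.
match goal with H : pre_step _ (_, pad _ _) _ _ _ _ |- _ =>
  have [P2 -> st'] := IH _ _ _ _ _ H nmu end.
by exists P2.
Qed.

Lemma out_step_inv (G : env) M c vs P mu k G' M' P' :
  pre_step G (M, Out (Ch c) vs P) mu k G' (M', P') -> ~~ env_label mu ->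
  exists G0 D Us a ds, [/\ G = G0 `+` Ch c :- [Us]^a, decr (Ch c) Us a = Some D,
     G' = G0 `+` D `+` binds (map Ch ds) Us, (size ds = size Us /\ vs = map Ch ds)
   & [/\ mu = LOut c ds, k = 0%R, M' = M & P' = P]].
Proof. by move=> st nmu; inversion st; subst=> //; exists G0, D, Us, a, ds. Qed.

Lemma in_step_inv (G : env) M c xs P mu k G' M' P' :
  pre_step G (M, In (Ch c) xs P) mu k G' (M', P') -> ~~ env_label mu ->
  exists G0 D Us a ds, [/\ G = G0 `+` Ch c :- [Us]^a `+` binds (map Ch ds) Us,
     decr (Ch c) Us a = Some D, G' = G0 `+` D, (size ds = size Us /\ size xs = size Us)
   & [/\ mu = LIn c ds, k = 0%R, M' = M & P' = subst (chan_subst xs ds) P]].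
Proof. by move=> st nmu; inversion st; subst=> //; exists G0, D, Us, a, ds. Qed.

Lemma free_step_inv (G : env) M c P mu k G' M' P' :
  pre_step G (M, Free (Ch c) P) mu k G' (M', P') -> ~~ env_label mu ->
  [/\ mu = LTau, k = (- 1)%R, G' = G, P' = P & M = (c |` M')%classic /\ ~ M' c].
Proof. by move=> st nmu; inversion st; subst. Qed.

Lemma rec_step_inv (G : env) M w P mu k G' M' P' :
  pre_step G (M, Rec w P) mu k G' (M', P') -> ~~ env_label mu ->
  [/\ mu = LTau, k = 0%R, G' = G, M' = M & P' = subst_proc w (Rec w P) P].
Proof. by move=> st nmu; inversion st; subst. Qed.

Lemma map_Ch_inj : injective (map Ch).
Proof. by apply: inj_map => c e []. Qed.

(** An output on [d] is visible only when the observer's environment types [d], and a recursion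
    offers no input to communicate with, so only its unfolding remains. *)
Lemma rec_out_step_inv (G : env) M w P d vs mu k G' M' P' : ~ dom G (Ch d) ->
  pre_step G (M, Par (Rec w P) (Out (Ch d) vs PNil)) mu k G' (M', P') ->
  ~~ env_label mu ->
  [/\ mu = LTau, k = 0%R, G' = G, M' = M
    & P' = Par (subst_proc w (Rec w P) P) (Out (Ch d) vs PNil)].
Proof.
move=> nGd st nmu; inversion st; subst=> //; try match goal with
  H : pre_step _ (_, Rec _ _) _ _ _ _ |- _ => by case: (rec_step_inv H) => // -> -> -> -> ->
end.
match goal with H : pre_step _ (_, Out _ _ _) _ _ _ _ |- _ =>
  have [? [? [? [? [? [eG _ _ _ _]]]]]] := out_step_inv H nmu end.
by case: nGd; rewrite eG dom_add dom1; right.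
Qed.

(** Neither end is visible without an assumption on [d] in [G]. Their communication survives,
    because its premises carry environments unrelated to [G]. *)
Lemma in_out_step_inv (G : env) M d x P v mu k G' M' P' : ~ dom G (Ch d) ->
  pre_step G (M, Par (In (Ch d) [:: x] P) (Out (Ch d) [:: Ch v] PNil)) mu k G' (M', P') ->
  ~~ env_label mu ->
  [/\ mu = LTau, k = 0%R, G' = G, M' = M
    & P' = Par (subst (chan_subst [:: x] [:: v]) P) PNil].
Proof.
move=> nGd st nmu; inversion st; subst=> //.
- match goal with H : pre_step _ (_, In _ _ _) _ _ _ _ |- _ =>
    by have [? [? [? [? [? [_ _ _ _ []]]]]]] := in_step_inv H isT end.
- match goal with H : pre_step _ (_, In _ _ _) _ _ _ _, H' : pre_step _ (_, Out _ _ _) _ _ _ _ |- _ =>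
    have [? [? [? [? [? [_ _ _ _ [[_ <-] _ _ ->]]]]]]] := in_step_inv H isT;
    have [? [? [? [? [? [_ _ _ [_ eds] [[_ e] _ _ ->]]]]]]] := out_step_inv H' isT end.
  by rewrite -e in eds; move/(@map_Ch_inj [:: v]): eds => <-.
- match goal with H : pre_step _ (_, In _ _ _) _ _ _ _ |- _ =>
    have [? [? [? [? [? [eG _ _ _ _]]]]]] := in_step_inv H nmu end.
  by case: nGd; rewrite eG !dom_add dom1; left; right.
- match goal with H : pre_step _ (_, Out _ _ _) _ _ _ _ |- _ =>
    have [? [? [? [? [? [eG _ _ _ _]]]]]] := out_step_inv H nmu end.
  by case: nGd; rewrite eG dom_add dom1; right.
Qed.

(** * Typing the back-ends *)

Lemma binds1 u (U : chty) : binds [:: u] [:: U] = u :- U.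
Proof. exact: seq_mset1. Qed.

Lemma binds2 u v (U V : chty) : binds [:: u; v] [:: U; V] = u :- U `+` v :- V.
Proof. by rewrite /assume -!seq_mset1 -seq_mset_cat. Qed.

Lemma typed_nil (G : env) : typed G PNil.
Proof. by apply: t_str t_nil _; rewrite -[G]mset0D; apply: struct_le_weak. Qed.

Lemma typed_weak (G H : env) P : typed G P -> typed (G `+` H) P.
Proof. by move=> tP; apply: t_str tP _; apply: struct_le_weak. Qed.

Lemma typed_pad n (G : env) P : typed G P -> typed G (pad n P).
Proof. by move=> tP; elim: n => //= n IH; rewrite -[G]msetD0; apply: t_par t_nil. Qed.

Lemma closed_pad n P : closed_proc P -> closed_proc (pad n P).
Proof. by move=> cP; elim: n => //= n; rewrite /closed_proc /= => ->. Qed.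

Lemma dom_in_struct (G G' : env) M : G ≺ G' -> dom_in G M -> dom_in G' M.
Proof. by move=> le dG u /(struct_le_dom le)/dG. Qed.

Section BackEnds.

Variables (T : chty) (x y z w : var).
Hypothesis uniq_vars : uniq [:: x; y; z; w].

Definition rec_payload : seq chty := [:: T; T_rec T].

Inductive stage : Type :=
| Ready of chan
| Received of chan & chan & chan
| Freed of chan & chan
| Sent of chan
| Unrolled of chan.

Definition rename_stage (s : chan -> chan) (st : stage) : stage :=
  match st with
  | Ready c => Ready (s c)
  | Received c v1 v2 => Received (s c) (s v1) (s v2)
  | Freed v1 v2 => Freed (s v1) (s v2)
  | Sent v => Sent (s v)
  | Unrolled v => Unrolled (s v)
  end.

Definition emit (P : proc) (out d : chan) (v1 v2 : ident) : proc :=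
  Out (Ch out) [:: v1] (Par P (Out (Ch d) [:: v2] PNil)).

Definition eager_at (out d : chan) (st : stage) : proc :=
  let E := eBk out d x y z w in
  match st with
  | Ready c => eBk'' out d x y z w c
  | Received c v1 v2 => Free (Ch c) (emit E out d (Ch v1) (Ch v2))
  | Freed v1 v2 => emit E out d (Ch v1) (Ch v2)
  | Sent v => Par E (Out (Ch d) [:: Ch v] PNil)
  | Unrolled v =>
      Par (In (Ch d) [:: x] (In (Va x) [:: y; z]
             (Free (Va x) (emit E out d (Va y) (Va z)))))
          (Out (Ch d) [:: Ch v] PNil)
  end.

(* The lazy back-end does not free, so it answers the step from [Received] to
   [Freed] by staying put. *)
Definition lazy_at (out d : chan) (st : stage) : proc :=
  let B := Bck out d x y z w in
  match st with
  | Ready c => Bck'' out d x y z w c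
  | Received _ v1 v2 | Freed v1 v2 => emit B out d (Ch v1) (Ch v2)
  | Sent v => Par B (Out (Ch d) [:: Ch v] PNil)
  | Unrolled v =>
      Par (In (Ch d) [:: x] (In (Va x) [:: y; z] (emit B out d (Va y) (Va z))))
          (Out (Ch d) [:: Ch v] PNil)
  end.

Definition base_env (out d : chan) : env :=
  Ch out :- [[:: T]]^Unr `+` Ch d :- [[:: T_rec T]]^Unr.

(** One environment types both back-ends. After reception [Uni 1] has been decremented to [Uni 0]:
    the eager process needs this to free [c], while the lazy one discards it by weakening. *)
Definition stage_env (out d : chan) (st : stage) : env :=
  base_env out d `+`
  match st with
  | Ready c => Ch c :- [rec_payload]^(Uni 1)
  | Received c v1 v2 =>
      Ch v1 :- T `+` Ch v2 :- T_rec T `+` Ch c :- [rec_payload]^(Uni 0)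
  | Freed v1 v2 => Ch v1 :- T `+` Ch v2 :- T_rec T
  | Sent v | Unrolled v => Ch v :- T_rec T
  end.

Lemma vars_neq :
  ((x == y) = false) * ((x == z) = false) * ((x == w) = false) *
  ((y == x) = false) * ((y == z) = false) * ((y == w) = false) *
  ((z == x) = false) * ((z == y) = false) * ((z == w) = false) *
  ((w == x) = false) * ((w == y) = false) * ((w == z) = false).
Proof.
move: uniq_vars; rewrite /= !inE !negb_or.
move=> /and4P[/and3P[/negPf xy /negPf xz /negPf xw] /andP[/negPf yz /negPf yw] /negPf zw _].
by rewrite ![z == _]eq_sym ![w == _]eq_sym ![y == x]eq_sym xy xz xw yz yw zw.
Qed.

(** [G] is the assumption [w : proc] inside the recursion, and a second copy of [base_env] once the
    recursion has replaced [w]. *)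
Lemma typed_emit (G : env) P out d v1 v2 : typed G P ->
  typed (G `+` base_env out d `+` v1 :- T `+` v2 :- T_rec T) (emit P out d v1 v2).
Proof.
move=> tP; rewrite /emit.
have -> : G `+` base_env out d `+` v1 :- T `+` v2 :- T_rec T =
    (G `+` (Ch d :- [[:: T_rec T]]^Unr `+` v2 :- T_rec T)) `+` Ch out :- [[:: T]]^Unr
    `+` binds [:: v1] [:: T].
  by rewrite binds1 /base_env; mset_ac.
apply: t_out => //; apply: typed_weak; apply: t_par => //.
rewrite -[X in X `+` _]mset0D -(binds1 v2); apply: t_out => //; exact: typed_nil.
Qed.

Lemma typed_receive (G : env) u P :
  (forall v, v \in [:: y; z] -> u <> Va v /\ ~ dom G (Va v)) ->
  typed (G `+` u :- [rec_payload]^(Uni 0) `+` Va y :- T `+` Va z :- T_rec T) P ->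
  typed (G `+` u :- [rec_payload]^(Uni 1)) (In u [:: y; z] P).
Proof.
move=> fresh tP; apply: t_in => //=; first by rewrite inE vars_neq.
  by move=> v /fresh[nu nG]; rewrite dom_add dom1 => -[//|/esym].
by rewrite binds2 msetDA.
Qed.

Lemma dom_base out d v : ~ dom (base_env out d) (Va v).
Proof. by rewrite /base_env dom_add !dom1 => -[]. Qed.

Lemma base_env_dup out d : base_env out d ≺ base_env out d `+` base_env out d.
Proof.
have -> : base_env out d `+` base_env out d =
    (Ch d :- [[:: T_rec T]]^Unr `+` Ch d :- [[:: T_rec T]]^Unr)
    `+` Ch out :- [[:: T]]^Unr `+` Ch out :- [[:: T]]^Unr by rewrite /base_env; mset_ac.
apply: (@str_trans _ (base_env out d `+` Ch d :- [[:: T_rec T]]^Unr)).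
  exact/str_split/split_unr.
have -> : base_env out d `+` Ch d :- [[:: T_rec T]]^Unr =
    (Ch d :- [[:: T_rec T]]^Unr `+` Ch d :- [[:: T_rec T]]^Unr)
    `+` Ch out :- [[:: T]]^Unr by rewrite /base_env; mset_ac.
exact/str_split/split_unr.
Qed.

Lemma typed_loop out d P :
  typed (base_env out d `+` Va w :- TyProc `+` Va x :- [rec_payload]^(Uni 1)) P ->
  typed (base_env out d) (Rec w (In (Ch d) [:: x] P)).
Proof.
move=> tP; apply: t_rec; last 1 first.
- have -> : base_env out d `+` Va w :- TyProc =
      Ch out :- [[:: T]]^Unr `+` Va w :- TyProc `+` Ch d :- [[:: T_rec T]]^Unr.
    by rewrite /base_env; mset_ac.
  apply: t_in => //=.
    by move=> v; rewrite inE !dom_add !dom1 => /eqP-> -[[//|[/eqP]]|//]; rewrite vars_neq.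
  rewrite binds1; apply: t_str tP _.
  have -> : Ch out :- [[:: T]]^Unr `+` Va w :- TyProc `+` Ch d :- [[:: T_rec T]]^Unr =
      base_env out d `+` Va w :- TyProc by rewrite /base_env; mset_ac.
  exact/str_eq/T_rec_unfold.
- move=> u U; rewrite /base_env in_msetD !in_mset1 => /orP[]/eqP[_ ->]; right;
    [by exists [:: T] | by exists [:: T_rec T]].
- exact: dom_base.
Qed.

Lemma typed_receive_var (G : env) P :
  (forall v, v \in [:: y; z] -> ~ dom G (Va v)) ->
  typed (G `+` Va x :- [rec_payload]^(Uni 0) `+` Va y :- T `+` Va z :- T_rec T) P ->
  typed (G `+` Va x :- [rec_payload]^(Uni 1)) (In (Va x) [:: y; z] P).
Proof.
move=> nG; apply: typed_receive => v vyz; split; last exact: nG.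
by case=> exv; move: vyz; rewrite -exv !inE !vars_neq.
Qed.

Lemma fresh_base_rec out d v :
  v \in [:: y; z] -> ~ dom (base_env out d `+` Va w :- TyProc) (Va v).
Proof.
by move=> vyz; rewrite dom_add dom1 => -[/dom_base//|[ev]]; move: vyz; rewrite ev !inE !vars_neq.
Qed.

Lemma typed_eBk out d : typed (base_env out d) (eBk out d x y z w).
Proof.
apply: typed_loop; apply: typed_receive_var; first exact: fresh_base_rec.
set B := base_env out d.
have -> : B `+` Va w :- TyProc `+` Va x :- [rec_payload]^(Uni 0) `+` Va y :- T `+` Va z :- T_rec T =
   Va w :- TyProc `+` B `+` Va y :- T `+` Va z :- T_rec T `+` Va x :- [rec_payload]^(Uni 0) by mset_ac.
by apply: t_free; apply: typed_emit; apply: t_var.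
Qed.

Lemma typed_Bck out d : typed (base_env out d) (Bck out d x y z w).
Proof.
apply: typed_loop; apply: typed_receive_var; first exact: fresh_base_rec.
set B := base_env out d.
have -> : B `+` Va w :- TyProc `+` Va x :- [rec_payload]^(Uni 0) `+` Va y :- T `+` Va z :- T_rec T =
   Va w :- TyProc `+` B `+` Va y :- T `+` Va z :- T_rec T `+` Va x :- [rec_payload]^(Uni 0) by mset_ac.
by apply: typed_weak; apply: typed_emit; apply: t_var.
Qed.

Lemma typed_emit_base P out d v1 v2 : typed (base_env out d) P ->
  typed (base_env out d `+` v1 :- T `+` v2 :- T_rec T) (emit P out d v1 v2).
Proof.
move=> tP; apply: t_str (typed_emit _ _ _ _ tP) _; do 2 apply: struct_le_add.
exact: base_env_dup.
Qed.

Lemma typed_send P out d v : typed (base_env out d) P ->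
  typed (base_env out d `+` v :- T_rec T) (Par P (Out (Ch d) [:: v] PNil)).
Proof.
move=> tP; apply: (@t_str _ (base_env out d `+` (base_env out d `+` v :- T_rec T))); last first.
  by rewrite msetDA; apply/struct_le_add/base_env_dup.
apply: t_par => //; rewrite -(binds1 v); apply: t_out => //; exact: typed_nil.
Qed.

Lemma typed_receive_chan P out d c :
  typed (base_env out d `+` Ch c :- [rec_payload]^(Uni 0) `+` Va y :- T `+` Va z :- T_rec T) P ->
  typed (base_env out d `+` Ch c :- [rec_payload]^(Uni 1)) (In (Ch c) [:: y; z] P).
Proof. by apply: typed_receive => v _; split=> //; apply: dom_base. Qed.

Lemma typed_listen P out d :
  typed (base_env out d `+` Va x :- [rec_payload]^(Uni 1)) P ->
  typed (base_env out d) (In (Ch d) [:: x] P).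
Proof.
move=> tP; apply: t_in => //=.
  by move=> v _; apply: dom_base.
by rewrite binds1; apply: t_str tP _; apply/str_eq/T_rec_unfold.
Qed.

Lemma typed_eager out d st : typed (stage_env out d st) (eager_at out d st).
Proof.
have tE := typed_eBk out d; case: st => [c|c v1 v2|v1 v2|v|v] /=.
- apply: typed_receive_chan.
  have -> (B C D E : env) : B `+` C `+` D `+` E = B `+` D `+` E `+` C by mset_ac.
  by apply: t_free; apply: typed_emit_base.
- by rewrite /stage_env !msetDA; apply: t_free; apply: typed_emit_base.
- by rewrite /stage_env !msetDA; apply: typed_emit_base.
- exact: typed_send.
- apply/typed_send/typed_listen/typed_receive_var; first by move=> v' _; apply: dom_base.
  have -> (B C D E : env) : B `+` C `+` D `+` E = B `+` D `+` E `+` C by mset_ac.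
  by apply: t_free; apply: typed_emit_base.
Qed.

Lemma typed_lazy out d st : typed (stage_env out d st) (lazy_at out d st).
Proof.
have tB := typed_Bck out d; case: st => [c|c v1 v2|v1 v2|v|v] /=.
- apply: typed_receive_chan.
  have -> (B C D E : env) : B `+` C `+` D `+` E = B `+` D `+` E `+` C by mset_ac.
  by apply: typed_weak; apply: typed_emit_base.
- by rewrite /stage_env !msetDA; apply: typed_weak; apply: typed_emit_base.
- by rewrite /stage_env !msetDA; apply: typed_emit_base.
- exact: typed_send.
- apply/typed_send/typed_listen/typed_receive_var; first by move=> v' _; apply: dom_base.
  have -> (B C D E : env) : B `+` C `+` D `+` E = B `+` D `+` E `+` C by mset_ac.
  by apply: typed_weak; apply: typed_emit_base.
Qed.

Lemma closed_eager out d st : closed_proc (eager_at out d st).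
Proof.
case: st => *; rewrite /closed_proc /=; do ?[progress rewrite ?inE ?eqxx ?vars_neq ?orbT /=].
all: by [].
Qed.

Lemma closed_lazy out d st : closed_proc (lazy_at out d st).
Proof.
case: st => *; rewrite /closed_proc /=; do ?[progress rewrite ?inE ?eqxx ?vars_neq ?orbT /=].
all: by [].
Qed.

Lemma subst_eBk f out d : subst f (eBk out d x y z w) = eBk out d x y z w.
Proof.
by rewrite /eBk /= /hide_vars; do ?[progress rewrite ?inE ?eqxx ?vars_neq ?orbT /=].
Qed.

Lemma subst_Bck f out d : subst f (Bck out d x y z w) = Bck out d x y z w.
Proof.
by rewrite /Bck /= /hide_vars; do ?[progress rewrite ?inE ?eqxx ?vars_neq ?orbT /=].
Qed.

Lemma subst_emit P out d v1 v2 :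
  (forall f, subst f P = P) ->
  subst (chan_subst [:: y; z] [:: v1; v2]) (emit P out d (Va y) (Va z)) =
  emit P out d (Ch v1) (Ch v2).
Proof.
move=> sP; rewrite /emit /= sP /chan_subst.
by do ?[progress rewrite ?inE ?eqxx ?vars_neq ?orbT /=].
Qed.

Lemma subst_listen_eager out d v :
  subst (chan_subst [:: x] [:: v]) (In (Va x) [:: y; z]
    (Free (Va x) (emit (eBk out d x y z w) out d (Va y) (Va z)))) =
  eager_at out d (Ready v).
Proof.
have sE f := subst_eBk f out d; rewrite /eager_at /eBk''; move: (eBk out d x y z w) sE => P sP.
rewrite /emit /= sP /hide_vars /chan_subst.
by do ?[progress rewrite ?inE ?eqxx ?vars_neq ?orbT /=].
Qed.

Lemma subst_listen_lazy out d v :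
  subst (chan_subst [:: x] [:: v]) (In (Va x) [:: y; z]
    (emit (Bck out d x y z w) out d (Va y) (Va z))) =
  lazy_at out d (Ready v).
Proof.
have sB f := subst_Bck f out d; rewrite /lazy_at /Bck''; move: (Bck out d x y z w) sB => P sP.
rewrite /emit /= sP /hide_vars /chan_subst.
by do ?[progress rewrite ?inE ?eqxx ?vars_neq ?orbT /=].
Qed.

Lemma unroll_eager out d v :
  Par (subst_proc w (eBk out d x y z w) (In (Ch d) [:: x] (In (Va x) [:: y; z]
    (Free (Va x) (emit (PVar w) out d (Va y) (Va z)))))) (Out (Ch d) [:: Ch v] PNil) =
  eager_at out d (Unrolled v).
Proof.
by rewrite /emit [LHS]/=; do ?[progress rewrite ?inE ?eqxx ?vars_neq ?orbT /=].
Qed.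

Lemma unroll_lazy out d v :
  Par (subst_proc w (Bck out d x y z w) (In (Ch d) [:: x] (In (Va x) [:: y; z]
    (emit (PVar w) out d (Va y) (Va z))))) (Out (Ch d) [:: Ch v] PNil) =
  lazy_at out d (Unrolled v).
Proof.
by rewrite /emit [LHS]/=; do ?[progress rewrite ?inE ?eqxx ?vars_neq ?orbT /=].
Qed.

Lemma rename_eager s out d st :
  rename s (eager_at out d st) = eager_at (s out) (s d) (rename_stage s st).
Proof. by case: st. Qed.

Lemma rename_lazy s out d st :
  rename s (lazy_at out d st) = lazy_at (s out) (s d) (rename_stage s st).
Proof. by case: st. Qed.

(** * Transitions of the back-ends *)

Lemma eager_receive out d c v1 v2 (G0 : env) D Us a M :
  size [:: v1; v2] = size Us -> decr (Ch c) Us a = Some D ->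
  pre_step (G0 `+` Ch c :- [Us]^a `+` binds (map Ch [:: v1; v2]) Us)
    (M, eager_at out d (Ready c)) (LIn c [:: v1; v2]) 0
    (G0 `+` D) (M, eager_at out d (Received c v1 v2)).
Proof.
move=> szU dec; rewrite [eager_at _ _ (Received _ _ _)]/= -(subst_emit _ _ _ _ (fun f => subst_eBk f out d)).
exact: (@s_in G0 D M c Us a [:: v1; v2] [:: y; z]
  (Free (Ch c) (emit (eBk out d x y z w) out d (Va y) (Va z)))).
Qed.

Lemma lazy_receive out d c v1 v2 (G0 : env) D Us a M :
  size [:: v1; v2] = size Us -> decr (Ch c) Us a = Some D ->
  pre_step (G0 `+` Ch c :- [Us]^a `+` binds (map Ch [:: v1; v2]) Us)
    (M, lazy_at out d (Ready c)) (LIn c [:: v1; v2]) 0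
    (G0 `+` D) (M, lazy_at out d (Received c v1 v2)).
Proof.
move=> szU dec; rewrite [lazy_at _ _ (Received _ _ _)]/= -(subst_emit _ _ _ _ (fun f => subst_Bck f out d)).
exact: (@s_in G0 D M c Us a [:: v1; v2] [:: y; z]
  (emit (Bck out d x y z w) out d (Va y) (Va z))).
Qed.

Lemma eager_send out d v1 v2 (G0 : env) D Us a M :
  size [:: v1] = size Us -> decr (Ch out) Us a = Some D ->
  pre_step (G0 `+` Ch out :- [Us]^a) (M, eager_at out d (Freed v1 v2)) (LOut out [:: v1]) 0
    (G0 `+` D `+` binds (map Ch [:: v1]) Us) (M, eager_at out d (Sent v2)).
Proof. exact: s_out. Qed.

Lemma lazy_send out d v1 v2 (G0 : env) D Us a M :
  size [:: v1] = size Us -> decr (Ch out) Us a = Some D ->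
  pre_step (G0 `+` Ch out :- [Us]^a) (M, lazy_at out d (Freed v1 v2)) (LOut out [:: v1]) 0
    (G0 `+` D `+` binds (map Ch [:: v1]) Us) (M, lazy_at out d (Sent v2)).
Proof. exact: s_out. Qed.

Lemma eager_unroll out d v (G : env) M :
  pre_step G (M, eager_at out d (Sent v)) LTau 0 G (M, eager_at out d (Unrolled v)).
Proof. by rewrite -unroll_eager; apply/s_par_l/s_rec. Qed.

Lemma lazy_unroll out d v (G : env) M :
  pre_step G (M, lazy_at out d (Sent v)) LTau 0 G (M, lazy_at out d (Unrolled v)).
Proof. by rewrite -unroll_lazy; apply/s_par_l/s_rec. Qed.

Lemma com_step (G : env) M c u P Q v :
  pre_step G (M, Par (In (Ch c) [:: u] P) (Out (Ch c) [:: Ch v] Q)) LTau 0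
    G (M, Par (subst (chan_subst [:: u] [:: v]) P) Q).
Proof.
(* The environments of the premises are free; an affine assumption on [c] with a one-element payload
   is enough to let both ends fire. *)
apply: (@s_com_r G _ _ _ _ M c [:: v]).
  exact: (@s_in mset0 _ M c [:: T] Aff [:: v] [:: u]).
exact: (@s_out mset0 _ M c [:: T] Aff [:: v]).
Qed.

Lemma eager_listen out d v (G : env) M :
  pre_step G (M, eager_at out d (Unrolled v)) LTau 0
    G (M, pad 1 (eager_at out d (Ready v))).
Proof. by rewrite -subst_listen_eager; apply: com_step. Qed.

Lemma lazy_listen out d v (G : env) M :
  pre_step G (M, lazy_at out d (Unrolled v)) LTau 0
    G (M, pad 1 (lazy_at out d (Ready v))).
Proof. by rewrite -subst_listen_lazy; apply: com_step. Qed.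

(** * The bisimulation *)

(** The eager side has freed channels that the lazy side still owns, whence the inclusion of [M] in
    [N]; the domain is required in the smaller [M], so that it is allocated on both sides. The last
    field concerns the value about to be sent on [out]: were it [d], the observer would learn [d],
    and types do not exclude this since [T] is arbitrary. *)
Record coherent (out d : chan) (st : stage) (G : env) (M N : set chan) : Prop := Coherent {
  coherent_resource : resource_env N;
  coherent_sub : forall c, M c -> N c;
  coherent_dom : dom_in (G `+` stage_env out d st) M;
  coherent_private : ~ dom G (Ch d);
  coherent_consistent : consistent (G `+` stage_env out d st);
  coherent_payload :
    match st with Received _ v _ | Freed v _ => v <> d | _ => True end }.

Lemma coherent_struct out d st st' (G G' : env) M N :
  coherent out d st G M N -> G `+` stage_env out d st ≺ G' `+` stage_env out d st' ->
  ~ dom G' (Ch d) ->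
  match st' with Received _ v _ | Freed v _ => v <> d | _ => True end ->
  coherent out d st' G' M N.
Proof.
case=> rN sMN dG _ cG _ le nd pay; split=> //; first exact: dom_in_struct dG.
exact: consistent_struct cG le.
Qed.

Lemma coherent_configuration out d st n (G : env) M N : coherent out d st G M N ->
  configuration G (M, pad n (eager_at out d st)) /\ configuration G (N, pad n (lazy_at out d st)).
Proof.
case=> rN sMN dG _ cG _.
have dGN : dom_in (G `+` stage_env out d st) N.
  by move=> u /dG[c -> /sMN]; exists c.
have cD : consistent (stage_env out d st).
  by apply: consistent_struct cG _; rewrite msetDC; apply: struct_le_weak.
have dl H : dom_in (G `+` stage_env out d st) H -> dom_in G H.
  by move=> dH u Gu; apply: dH; rewrite dom_add; left.
have dr H : dom_in (G `+` stage_env out d st) H -> dom_in (stage_env out d st) H.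
  by move=> dH u Gu; apply: dH; rewrite dom_add; right.
(* The stage environment is the witness [D] for both processes. *)
split; (split; [split|exact: dl|exists (stage_env out d st); split=> //; split=> //; try exact: dr]).
- exact: resource_env_sub sMN rN.
- exact/closed_pad/closed_eager.
- exact/typed_pad/typed_eager.
- exact: rN.
- exact/closed_pad/closed_lazy.
- exact/typed_pad/typed_lazy.
Qed.

Lemma stage_env_rename s out d st :
  env_pmap (fun u => Some (rename_ident s u)) (stage_env out d st) =
  stage_env (s out) (s d) (rename_stage s st).
Proof. by case: st => *; rewrite /stage_env /base_env !env_pmapD !env_pmap1. Qed.

Lemma coherent_rename s out d st (G : env) M N : bijective s -> fixes s G ->
  coherent out d st G M N ->
  coherent (s out) (s d) (rename_stage s st) G (s @` M)%classic (s @` N)%classic.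
Proof.
move=> bs fs [rN sMN dG nd cG pay]; have sI := bij_inj bs.
have GE : env_pmap (fun u => Some (rename_ident s u)) G = G.
  apply: env_pmap_id => u Gu; have [c eu _] : exists2 c, u = Ch c & M c.
    by apply: dG; rewrite dom_add; left.
  by rewrite eu /= fs // -eu.
have GDE : G `+` stage_env (s out) (s d) (rename_stage s st) =
    env_pmap (fun u => Some (rename_ident s u)) (G `+` stage_env out d st).
  by rewrite env_pmapD GE stage_env_rename.
split.
- exact: resource_env_image.
- by move=> _ [c /sMN Nc <-]; exists c.
- rewrite GDE => u [U]; rewrite (perm_mem (perm_eq_seq_mset _)) mem_pmap.
  case/mapP=> -[v V] /= vV [-> _]; have [c -> Mc] : exists2 c, v = Ch c & M c.
    by apply: dG; exists V.
  by exists (s c) => //; exists c.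
- by move=> Gsd; apply: nd; rewrite -(sI _ _ (fs _ Gsd)).
- rewrite GDE; apply: consistent_pmap cG => u v u' [<-] [].
  by case: u v => [c|c] [e|e] //= [e1]; rewrite ?e1 // (sI _ _ e1).
- by case: st pay {dG cG GDE} => //= *; move/sI.
Qed.

Lemma stage_fixed s out d st : (forall c, dom (stage_env out d st) (Ch c) -> s c = c) ->
  [/\ s out = out, s d = d & rename_stage s st = st].
Proof.
rewrite /stage_env /base_env => H.
have {}H c : dom (Ch out :- [[:: T]]^Unr `+` Ch d :- [[:: T_rec T]]^Unr) (Ch c) \/
    dom (match st with
  | Ready c => Ch c :- [rec_payload]^(Uni 1)
  | Received c v1 v2 =>
      Ch v1 :- T `+` Ch v2 :- T_rec T `+` Ch c :- [rec_payload]^(Uni 0)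
  | Freed v1 v2 => Ch v1 :- T `+` Ch v2 :- T_rec T
  | Sent v | Unrolled v => Ch v :- T_rec T
  end) (Ch c) -> s c = c by move=> ?; apply: H; rewrite dom_add.
split; try by apply: H; left; rewrite dom_add !dom1; auto.
by case: st H => [c|c v1 v2|v1 v2|v|v] H; rewrite /= ?H //; right;
  rewrite ?dom_add !dom1; auto.
Qed.

(** Uniqueness excludes any other assumption on [c], so nothing in [G] refers to [c] once it is
    deallocated. In [coherent_free] this [G] contains the observer's assumptions together with those
    of the stage. *)
Lemma dom_in_unique (G : env) M c Us :
  dom_in (G `+` Ch c :- [Us]^(Uni 0)) (c |` M)%classic ->
  consistent (G `+` Ch c :- [Us]^(Uni 0)) -> dom_in G M.
Proof.
move=> dG cG u Gu; have [e eu Me] : exists2 e, u = Ch e & (c |` M)%classic e.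
  by apply: dG; rewrite dom_add; left.
exists e => //; case: Me => // ec.
by case: (consistent_unique cG); rewrite -ec -eu.
Qed.

(** [N'] is kept separate from [N] because the lazy side may first have to move its own copy of [c]
    out of the way. The allocated channel differs from [d], which already lies in [M]. *)
Lemma coherent_alloc out d st (G : env) M N N' c Us : coherent out d st G M N ->
  ~ M c -> resource_env N' -> (forall e, M e -> N' e) ->
  coherent out d st (G `+` Ch c :- [Us]^(Uni 0)) (c |` M)%classic (c |` N')%classic.
Proof.
case=> rN sMN dG nd cG pay nMc rN' sMN'.
have eG : G `+` Ch c :- [Us]^(Uni 0) `+` stage_env out d st =
  G `+` stage_env out d st `+` Ch c :- [Us]^(Uni 0) by mset_ac.
split=> //.
- exact: resource_env_add.
- by move=> e [->|/sMN']; [left|right].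
- rewrite eG => u; rewrite dom_add dom1 => -[/dG[e -> Me]|->]; first by exists e; last right.
  by exists c => //; left.
- rewrite dom_add dom1 => -[//|[edc]]; apply: nMc; rewrite -edc.
  have [|e [->] //] := dG (Ch d).
  by rewrite /stage_env /base_env !dom_add !dom1; auto.
- by rewrite eG; apply: consistent_fresh => // /dG[e [<-]].
Qed.

Lemma coherent_dealloc out d st (G : env) M N c Us :
  coherent out d st (G `+` Ch c :- [Us]^(Uni 0)) (c |` M)%classic (c |` N)%classic ->
  ~ M c -> coherent out d st G M N.
Proof.
case=> rN sMN dG nd cG pay nMc.
have eG : G `+` Ch c :- [Us]^(Uni 0) `+` stage_env out d st =
  G `+` stage_env out d st `+` Ch c :- [Us]^(Uni 0) by mset_ac.
rewrite eG in dG cG; split=> //.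
- by apply: resource_env_sub rN => e; right.
- by move=> e Me; case: (sMN e) => [|ec|//]; [right|rewrite ec in Me].
- exact: dom_in_unique dG cG.
- by move=> Gd; apply: nd; rewrite dom_add; left.
- by apply: consistent_struct cG _; apply: struct_le_weak.
Qed.

Lemma coherent_free out d c v1 v2 (G : env) M N :
  coherent out d (Received c v1 v2) G (c |` M)%classic N -> coherent out d (Freed v1 v2) G M N.
Proof.
have eG : G `+` stage_env out d (Received c v1 v2) =
    G `+` stage_env out d (Freed v1 v2) `+` Ch c :- [rec_payload]^(Uni 0).
  by rewrite /stage_env; mset_ac.
case=> rN sMN; rewrite eG => dG nd cG pay; split=> //.
- by move=> e Me; apply: sMN; right.
- exact: dom_in_unique dG cG.
- by apply: consistent_struct cG _; apply: struct_le_weak.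
Qed.

Lemma coherent_mem out d c v1 v2 (G : env) M N :
  coherent out d (Received c v1 v2) G M N -> M c.
Proof.
case=> _ _ dG _ _ _; have [|e [->] //] := dG (Ch c).
by rewrite /stage_env !dom_add !dom1; auto 6.
Qed.

(** Consistency forces the observer's assumption on [c] to be affine, so the input consumes it
    entirely. Joined with the [Uni 1] of the process it would give [Uni 0], which is exactly what
    the process holds after the input. *)
Lemma coherent_receive out d c ds (G0 : env) D Us a M N :
  size ds = size Us -> decr (Ch c) Us a = Some D ->
  coherent out d (Ready c) (G0 `+` Ch c :- [Us]^a `+` binds (map Ch ds) Us) M N ->
  exists v1 v2, ds = [:: v1; v2] /\ coherent out d (Received c v1 v2) (G0 `+` D) M N.
Proof.
move=> szU dec coh; set G := (G in coherent _ _ _ G) in coh.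
have eG : G `+` stage_env out d (Ready c) =
  G0 `+` binds (map Ch ds) Us `+` base_env out d `+` Ch c :- [Us]^a
    `+` Ch c :- [rec_payload]^(Uni 1) by rewrite /G /stage_env; mset_ac.
have cG := coherent_consistent coh; rewrite eG in cG.
have [ea eqU] := consistent_uni_aff (erefl : head_attr [rec_payload]^(Uni 1) = _)
  (same_payload_refl _) cG.
subst a; case: dec => eD; subst D.
have [U1 [U2 [eU eq1 eq2]]] : exists U1 U2, [/\ Us = [:: U1; U2], U1 ∼ T & U2 ∼ T_rec T].
  inversion eqU as [|U1 ? Us1 ? eq1 eqU1]; inversion eqU1 as [|U2 ? Us2 ? eq2 eqU2].
  by inversion eqU2; exists U1, U2.
have [v1 [v2 eds]] : exists v1 v2, ds = [:: v1; v2].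
  by move: szU; rewrite eU; case: (ds) => [|v1 [|v2 []]] //; exists v1, v2.
subst Us ds.
exists v1, v2; split=> //; apply: (coherent_struct coh).
- rewrite eG binds2.
  have -> : G0 `+` (Ch v1 :- U1 `+` Ch v2 :- U2) `+` base_env out d =
    G0 `+` base_env out d `+` Ch v1 :- U1 `+` Ch v2 :- U2 by mset_ac.
  set Us := [:: U1; U2].
  (* The observer's payload is equal to [rec_payload] only up to [∼]; it is rewritten first, since
     joining requires the same payload on both halves. *)
  apply: (@str_trans _ (G0 `+` base_env out d `+` Ch v1 :- U1 `+` Ch v2 :- U2
     `+` Ch c :- [rec_payload]^Aff `+` Ch c :- [rec_payload]^(Uni 1))).
    apply/struct_le_add/str_eq.
    exists (fun V W => ty_equiv V W \/ V = [Us]^Aff /\ W = [rec_payload]^Aff); split; last by right.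
    move=> V W [/ty_equiv_unfold[Vs [Ws [b [uV uW eqV]]]]|[-> ->]].
      by exists Vs, Ws, b; split=> //; apply: Forall2_sub eqV; left.
    exists (map ty_of_chty Us), (map ty_of_chty rec_payload), Aff.
    split; try exact: unfolds_chan.
    by do 2 (constructor; first by left); constructor.
  apply: str_trans; first exact/str_join/split_uni.
  rewrite /stage_env msetD0.
  have -> : G0 `+` (base_env out d `+` (Ch v1 :- T `+` Ch v2 :- T_rec T `+`
      Ch c :- [rec_payload]^(Uni 0))) = G0 `+` base_env out d `+` Ch v1 :- T
      `+` Ch v2 :- T_rec T `+` Ch c :- [rec_payload]^(Uni 0) by mset_ac.
  apply: struct_le_add; apply: str_trans (struct_le_add _ _); last exact: str_eq eq1.
  exact: str_eq.
- rewrite msetD0 => Gd; apply: (coherent_private coh).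
  by rewrite /G !dom_add; auto.
(* The received value was provided by the observer, whose environment does not mention [d]. *)
- move=> ev; apply: (coherent_private coh); rewrite -ev /G binds2 !dom_add !dom1; auto.
Qed.

(** The assumption on [v1] moves from the process to the observer, at an equal type since both agree
    on the payload of [out]. The observer's own assumption on [out] is either kept or, if affine,
    used up. *)
Lemma coherent_send out d v1 v2 ds (G0 : env) D Us a M N :
  size ds = size Us -> [:: Ch v1] = map Ch ds -> decr (Ch out) Us a = Some D ->
  coherent out d (Freed v1 v2) (G0 `+` Ch out :- [Us]^a) M N ->
  ds = [:: v1] /\ coherent out d (Sent v2) (G0 `+` D `+` binds (map Ch ds) Us) M N.
Proof.
move=> szU /(@map_Ch_inj [:: v1]) eds dec coh; subst ds; split=> //.
have e0 : G0 `+` Ch out :- [Us]^a `+` stage_env out d (Freed v1 v2) =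
  G0 `+` Ch d :- [[:: T_rec T]]^Unr `+` Ch v1 :- T `+` Ch v2 :- T_rec T `+` Ch out :- [Us]^a
  `+` Ch out :- [[:: T]]^Unr by rewrite /stage_env /base_env; mset_ac.
have cG := coherent_consistent coh; rewrite e0 in cG.
have [ea eqU] := consistent_unr cG.
have [U [eU eq1]] : exists U, Us = [:: U] /\ U ∼ T.
  by inversion eqU as [|U ? Us1 ? eq1 eqU1]; inversion eqU1; exists U.
subst Us; apply: (coherent_struct coh) => //.
- rewrite binds1.
  (* Decrementing is an instance of [≺] here: weakening for [Aff], reflexivity for [Unr]. *)
  have le : Ch out :- [[:: U]]^a ≺ D.
    case: ea dec => -> [<-]; last exact: str_refl.
    by rewrite -[X in X ≺ _]mset0D; apply: str_weak.
  have -> : G0 `+` D `+` Ch v1 :- U `+` stage_env out d (Sent v2) =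
    D `+` (G0 `+` stage_env out d (Sent v2)) `+` Ch v1 :- U by mset_ac.
  apply: (@str_trans _ (D `+` (G0 `+` stage_env out d (Sent v2)) `+` Ch v1 :- T)).
    have -> : G0 `+` Ch out :- [[:: U]]^a `+` stage_env out d (Freed v1 v2) =
      Ch out :- [[:: U]]^a `+` (G0 `+` stage_env out d (Sent v2)) `+` Ch v1 :- T.
      by rewrite /stage_env; mset_ac.
    by do 2 apply: struct_le_add.
  exact/str_eq/ty_equiv_sym.
- have DG : dom D (Ch d) -> dom (Ch out :- [[:: U]]^a) (Ch d).
    by case: ea dec => -> [<-] // /dom0.
  rewrite binds1 !dom_add dom1 => -[[Gd|/DG Gd]|[edv]].
  + by apply: (coherent_private coh); rewrite dom_add; left.
  + by apply: (coherent_private coh); rewrite dom_add; right.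
  + by apply: (coherent_payload coh).
Qed.

(** [out] and [d] vary with the pair: a renaming may move [d], which the observer does not know, and
    also [out] once the observer has dropped its assumption on it. *)
Inductive related (G : env) : system -> system -> Prop :=
| Related out d st n M N : coherent out d st G M N ->
    related G (M, pad n (eager_at out d st)) (N, pad n (lazy_at out d st)).

Lemma related_rename s (G : env) S1 S2 : bijective s -> fixes s G ->
  related G S1 S2 -> related G (rename_system s S1) (rename_system s S2).
Proof.
move=> bs fs [out d st n M N coh]; rewrite /rename_system /= !rename_pad rename_eager rename_lazy.
by constructor; apply: coherent_rename.
Qed.

(* The channel allocated by the environment may be one that only the lazy
   system still owns: there it is first renamed away. *)
Lemma env_forward out d st n (G : env) M N mu k G' M' :
  coherent out d st G M N -> env_step G M mu k G' M' ->
  exists N', step G (N, pad n (lazy_at out d st)) mu k G' (N', pad n (lazy_at out d st))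
    /\ coherent out d st G' M' N'.
Proof.
move=> coh st_; case: st_ coh => {G M mu k G' M'} [G G' M le|G M c Us nMc|G M c Us nMc] coh.
- exists N; split; first exact/step_pre/s_env.
  apply: (coherent_struct coh); first exact: struct_le_add.
    by move=> /(struct_le_dom le); apply: coherent_private coh.
  exact: coherent_payload coh.
- have [rN sMN dG _ _ _] := coh; have [e nNe] := resource_env_fresh rN.
  have sE i : M i -> swap c e i = i.
    by move=> Mi; apply: swap_id => ei; rewrite ei in Mi => //; apply/nNe/sMN.
  have [so sd sst] : [/\ swap c e out = out, swap c e d = d & rename_stage (swap c e) st = st].
    apply: stage_fixed => i Di; apply: sE; have [|j [->] //] := dG (Ch i).
    by rewrite dom_add; right.
  exists (c |` swap c e @` N)%classic; split.
    exists (swap c e); split; first exact: swap_bij.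
      move=> i Gi; apply: sE; have [|j [->] //] := dG (Ch i).
      by rewrite dom_add; left.
    rewrite /rename_system /= rename_pad rename_lazy so sd sst.
    apply: s_env_alloc => -[i Ni eic]; apply: nNe.
    by rewrite (_ : e = i) // -(swapK c e i) eic /swap eqxx.
  apply: (coherent_alloc Us coh nMc).
    exact/resource_env_image/rN/swap_bij.
  by move=> i Mi; exists i; [exact: sMN|exact: sE].
- have Nc : N c by apply: (coherent_sub coh); left.
  have eN : N = (c |` (N `\ c))%classic by rewrite setD1K.
  exists (N `\ c)%classic; split; first by rewrite {1}eN; apply/step_pre/s_env_free => -[_ /(_ erefl)].
  by apply: (@coherent_dealloc _ _ _ _ _ _ c Us); rewrite -?eN.
Qed.

Lemma env_backward out d st n (G : env) M N mu k G' N' :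
  coherent out d st G M N -> env_step G N mu k G' N' ->
  exists M', step G (M, pad n (eager_at out d st)) mu k G' (M', pad n (eager_at out d st))
    /\ coherent out d st G' M' N'.
Proof.
move=> coh st_; case: st_ coh => {G N mu k G' N'} [G G' N le|G N c Us nNc|G N c Us nNc] coh.
- exists M; split; first exact/step_pre/s_env.
  apply: (coherent_struct coh); first exact: struct_le_add.
    by move=> /(struct_le_dom le); apply: coherent_private coh.
  exact: coherent_payload coh.
- have nMc : ~ M c by move=> /(coherent_sub coh).
  exists (c |` M)%classic; split; first exact/step_pre/s_env_alloc.
  exact: (coherent_alloc Us coh nMc (coherent_resource coh) (coherent_sub coh)).
- have Mc : M c.
    have dG := coherent_dom coh; have [|e [->] //] := dG (Ch c).
    by rewrite !dom_add !dom1; auto.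
  have eM : M = (c |` (M `\ c))%classic by rewrite setD1K.
  exists (M `\ c)%classic; split; first by rewrite {1}eM; apply/step_pre/s_env_free => -[_ /(_ erefl)].
  by apply: (@coherent_dealloc _ _ _ _ _ _ c Us); rewrite -?eM // => -[_ /(_ erefl)].
Qed.

Lemma coherent_stage out d st st' (G : env) M N :
  stage_env out d st ≺ stage_env out d st' ->
  match st' with Received _ v _ | Freed v _ => v <> d | _ => True end ->
  coherent out d st G M N -> coherent out d st' G M N.
Proof.
move=> le pay coh; apply: (coherent_struct coh) => //; last exact: coherent_private coh.
by rewrite !(msetDC G); apply: struct_le_add.
Qed.

(** * Matching the transitions of related systems *)

Lemma related_forward (G : env) S1 S2 (n : nat) mu k G' S1' :
  related G S1 S2 -> pre_step G S1 mu k G' S1' ->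
  exists l S2' (n' : nat),
    [/\ weak_hat G S2 mu l G' S2', (n'%:Z = n%:Z + l - k)%R & related G' S1' S2'].
Proof.
case=> out d st m M N coh; case: S1' => M' P' pst.
have [emu|nmu] := boolP (env_label mu).
  have [/= -> est] := pre_step_env pst emu.
  have [N' [stN coh']] := env_forward m coh est.
  by exists k, (N', pad m (lazy_at out d st)), n; rewrite addrK; split=> //; exact: weak_step.
have {pst}[P -> pst] := pad_step_inv pst nmu.
have zero (i : int) : (i = i + 0 - 0)%R by rewrite addr0 subr0.
case: st coh pst => [c|c v1 v2|v1 v2|v|v] coh pst.
- have [G0 [D [Us [a [ds [eG dec eG' [szU _] [emu ek eM eP]]]]]]] := in_step_inv pst nmu.
  subst G G' mu k M' P; have [v1 [v2 [eds coh']]] := coherent_receive szU dec coh; subst ds.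
  exists 0%R, (N, pad m (lazy_at out d (Received c v1 v2))), n; split; [|exact: zero|].
    exact/weak_step/step_pre/pad_step/lazy_receive.
  rewrite (_ : subst _ _ = eager_at out d (Received c v1 v2)); first exact: Related.
  by rewrite [RHS]/= -(subst_emit _ _ _ _ (fun f => subst_eBk f out d)).
- have [emu ek eG eP [eM nMc]] := free_step_inv pst nmu; subst mu k G' P M.
  exists 0%R, (N, pad m (lazy_at out d (Freed v1 v2))), n.+1; split.
  + exact: taus_refl.
  + by rewrite addr0 opprK -PoszD addn1.
  + exact/(@Related _ _ _ (Freed v1 v2))/(coherent_free coh).
- have [G0 [D [Us [a [ds [eG dec eG' [szU evs] [emu ek eM eP]]]]]]] := out_step_inv pst nmu.
  subst G G' mu k M' P; have [eds coh'] := coherent_send szU evs dec coh; subst ds.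
  exists 0%R, (N, pad m (lazy_at out d (Sent v2))), n; split; [|exact: zero|].
    exact/weak_step/step_pre/pad_step/lazy_send.
  exact: (@Related _ _ _ (Sent v2)).
- have [emu ek eG eM eP] := rec_out_step_inv (coherent_private coh) pst nmu; subst mu k G' M' P.
  exists 0%R, (N, pad m (lazy_at out d (Unrolled v))), n; split; [|exact: zero|].
    exact/weak_step/step_pre/pad_step/lazy_unroll.
  by rewrite unroll_eager; constructor; apply: coherent_stage coh => //; apply: str_refl.
- have [emu ek eG eM eP] := in_out_step_inv (coherent_private coh) pst nmu; subst mu k G' M' P.
  exists 0%R, (N, pad m (pad 1 (lazy_at out d (Ready v)))), n; split; [|exact: zero|].
    exact/weak_step/step_pre/pad_step/lazy_listen.
  (* The [PNil] left by the communication becomes one more layer of padding, and the received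
     channel takes the role of [c] for the next round. *)
  rewrite subst_listen_eager -[Par _ _]/(pad 1 _) /pad -!iterD; constructor.
  by apply: coherent_stage coh => //; apply/str_eq/T_rec_unfold.
Qed.

Lemma related_backward (G : env) S1 S2 (n : nat) mu l G' S2' :
  related G S1 S2 -> pre_step G S2 mu l G' S2' ->
  exists k S1' (n' : nat),
    [/\ weak_hat G S1 mu k G' S1', (n'%:Z = n%:Z + l - k)%R & related G' S1' S2'].
Proof.
case=> out d st m M N coh; case: S2' => N' P' pst.
have [emu|nmu] := boolP (env_label mu).
  have [/= -> est] := pre_step_env pst emu.
  have [M' [stM coh']] := env_backward m coh est.
  by exists l, (M', pad m (eager_at out d st)), n; rewrite addrK; split=> //; exact: weak_step.
have {pst}[P -> pst] := pad_step_inv pst nmu.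
have zero (i : int) : (i = i + 0 - 0)%R by rewrite addr0 subr0.
case: st coh pst => [c|c v1 v2|v1 v2|v|v] coh pst.
- have [G0 [D [Us [a [ds [eG dec eG' [szU _] [emu ek eM eP]]]]]]] := in_step_inv pst nmu.
  subst G G' mu l N' P; have [v1 [v2 [eds coh']]] := coherent_receive szU dec coh; subst ds.
  exists 0%R, (M, pad m (eager_at out d (Received c v1 v2))), n; split; [|exact: zero|].
    exact/weak_step/step_pre/pad_step/eager_receive.
  rewrite (_ : subst _ _ = lazy_at out d (Received c v1 v2)); first exact: Related.
  exact: subst_emit (fun f => subst_Bck f out d).
- have [G0 [D [Us [a [ds [eG dec eG' [szU evs] [emu ek eM eP]]]]]]] := out_step_inv pst nmu.
  (* The lazy process is already sending. The eager one must free [c] before it can send, which its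
     weak output includes at cost -1; [c] is still allocated in [M] at this stage. *)
  have Mc := coherent_mem coh; have eMc : M = (c |` (M `\ c))%classic by rewrite setD1K.
  rewrite eMc in coh; have {}coh := coherent_free coh.
  subst G G' mu l N' P; have [eds coh'] := coherent_send szU evs dec coh; subst ds.
  exists (- 1)%R, ((M `\ c)%classic, pad m (eager_at out d (Sent v2))), n.+1; split.
  + exists (- 1)%R, 0%R, 0%R, (G0 `+` Ch out :- [Us]^a), ((M `\ c)%classic, pad m (eager_at out d (Freed v1 v2))).
    exists (G0 `+` D `+` binds (map Ch [:: v1]) Us), ((M `\ c)%classic, pad m (eager_at out d (Sent v2))).
    split; rewrite ?addr0 //; [|exact/step_pre/pad_step/eager_send|exact: taus_refl].
    rewrite -[(- 1)%R]addr0; apply: taus_step (taus_refl _ _); rewrite {1}eMc.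
    by apply/step_pre/pad_step/s_free => -[_ /(_ erefl)].
  + by rewrite addr0 opprK -PoszD addn1.
  + exact: (@Related _ _ _ (Sent v2)).
- have [G0 [D [Us [a [ds [eG dec eG' [szU evs] [emu ek eM eP]]]]]]] := out_step_inv pst nmu.
  subst G G' mu l N' P; have [eds coh'] := coherent_send szU evs dec coh; subst ds.
  exists 0%R, (M, pad m (eager_at out d (Sent v2))), n; split; [|exact: zero|].
    exact/weak_step/step_pre/pad_step/eager_send.
  exact: (@Related _ _ _ (Sent v2)).
- have [emu ek eG eM eP] := rec_out_step_inv (coherent_private coh) pst nmu; subst mu l G' N' P.
  exists 0%R, (M, pad m (eager_at out d (Unrolled v))), n; split; [|exact: zero|].
    exact/weak_step/step_pre/pad_step/eager_unroll.
  by rewrite unroll_lazy; constructor; apply: coherent_stage coh => //; apply: str_refl.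
- have [emu ek eG eM eP] := in_out_step_inv (coherent_private coh) pst nmu; subst mu l G' N' P.
  exists 0%R, (M, pad m (pad 1 (eager_at out d (Ready v)))), n; split; [|exact: zero|].
    exact/weak_step/step_pre/pad_step/eager_listen.
  rewrite subst_listen_lazy -[Par _ _]/(pad 1 _) /pad -!iterD; constructor.
  by apply: coherent_stage coh => //; apply/str_eq/T_rec_unfold.
Qed.

End BackEnds.

(** * The initial systems and the conclusion *)

Lemma related_configuration (T : chty) (x y z w : var) (G : env) S1 S2 :
  uniq [:: x; y; z; w] -> related T x y z w G S1 S2 ->
  configuration G S1 /\ configuration G S2.
Proof. by move=> uv [out d st n M N /(coherent_configuration uv n)]. Qed.

(** The functional witness holds [c1] at [Uni 0], which splits into the observer's [Aff] and the
    process's [Uni 1]. [inp] is split because both observer environments mention it, and [out]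
    because the observer and the process share it. *)
Lemma initial_consistent (T : chty) (inp out b d c1 : chan) :
  uniq [:: inp; out; b; d; c1] ->
  consistent (Gamma_ext T inp out `+` Gamma_Frn T inp b c1 `+`
    stage_env T out d (Ready c1)).
Proof.
move=> uc; pose rest : env := Ch b :- [[:: T_rec T]]^Unr `+` Ch d :- [[:: T_rec T]]^Unr.
apply: (@consistent_struct (rest `+` Ch inp :- [[:: T]]^Unr `+` Ch out :- [[:: T]]^Unr
    `+` Ch c1 :- [rec_payload T]^(Uni 0))).
  have -> : rest `+` Ch inp :- [[:: T]]^Unr `+` Ch out :- [[:: T]]^Unr
      `+` Ch c1 :- [rec_payload T]^(Uni 0) =
    seq_mset [:: (Ch inp, TyCh [[:: T]]^Unr); (Ch out, TyCh [[:: T]]^Unr);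
      (Ch b, TyCh [[:: T_rec T]]^Unr); (Ch d, TyCh [[:: T_rec T]]^Unr);
      (Ch c1, TyCh [rec_payload T]^(Uni 0))].
    by rewrite !seq_mset_cons seq_mset0 msetD0 /rest; mset_ac.
  apply: consistent_seq; rewrite -[map _ _]/(map Ch [:: inp; out; b; d; c1]).
  by rewrite map_inj_uniq // => ? ? [].
apply: str_trans; first exact/str_split/split_uni.
have -> : rest `+` Ch inp :- [[:: T]]^Unr `+` Ch out :- [[:: T]]^Unr
    `+` Ch c1 :- [rec_payload T]^Aff `+` Ch c1 :- [rec_payload T]^(Uni 1) =
  rest `+` Ch out :- [[:: T]]^Unr `+` Ch c1 :- [rec_payload T]^Aff
    `+` Ch c1 :- [rec_payload T]^(Uni 1) `+` Ch inp :- [[:: T]]^Unr by mset_ac.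
apply: str_trans; first exact/str_split/split_unr.
have -> : rest `+` Ch out :- [[:: T]]^Unr `+` Ch c1 :- [rec_payload T]^Aff
    `+` Ch c1 :- [rec_payload T]^(Uni 1) `+` Ch inp :- [[:: T]]^Unr
    `+` Ch inp :- [[:: T]]^Unr =
  rest `+` Ch c1 :- [rec_payload T]^Aff `+` Ch c1 :- [rec_payload T]^(Uni 1)
    `+` Ch inp :- [[:: T]]^Unr `+` Ch inp :- [[:: T]]^Unr `+` Ch out :- [[:: T]]^Unr by mset_ac.
apply: str_trans; first exact/str_split/split_unr.
set G1 := (G in G ≺ _); set G2 := (G in _ ≺ G); have -> : G1 = G2; last exact: str_refl.
by rewrite /G1 /G2 /rest /Gamma_ext /Gamma_Frn /stage_env /base_env /rec_payload; mset_ac.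
Qed.

Theorem theorem6p4 (T : chty) (inp out b d c1 : chan) (x y z w : var)
    (M : set chan) :
  uniq [:: inp; out; b; d; c1] -> uniq [:: x; y; z; w] ->
  resource_env M -> (forall c, c \in [:: inp; out; b; d; c1] -> M c) ->
  amortised_le (Gamma_ext T inp out `+` Gamma_Frn T inp b c1) 0
    (M, eBk'' out d x y z w c1) (M, Bck'' out d x y z w c1).
Proof.
move=> uc uv rM Mc.
exists (fun G n S1 S2 => exists s, [/\ bijective s, fixes s G
  & related T x y z w G S1 (rename_system s S2)]); split; last first.
  exists id; split=> //; first by exists id.
  rewrite rename_system_eqid //.
  apply: (@Related T x y z w _ out d (Ready c1) 0); split=> //.
  - move=> u; rewrite /Gamma_ext /Gamma_Frn /stage_env /base_env !dom_add !dom1 .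
    by move=> [[[|]|[[|]|]]|[[|]|]] ->; eexists; try reflexivity; apply: Mc;
      rewrite !inE eqxx ?orbT.
  - rewrite /Gamma_ext /Gamma_Frn !dom_add !dom1 => -[[|]|[[|]|]] [ed]; move: uc;
      by rewrite ed /= !inE !eqxx ?orbT /= ?andbF.
  - exact: initial_consistent.
move=> G n S1 S2 [s [bs fs rel]]; have [t sK tK] := bs.
have bt : bijective t by exists s.
have ft := fixes_inv sK fs.
have undo S : rename_system t (rename_system s S) = S.
  by rewrite rename_systemM rename_system_eqid.
split.
- by have [] := related_configuration uv rel.
- by have [] := related_configuration uv (related_rename bt ft rel); rewrite undo.
- move=> mu k G' S1' [r [br fr pst]].
  have [l [S2' [n' [wk en rel']]]] :=
    related_forward uv n (related_rename br fr rel) pst.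
  have brs := bij_comp br bs; rewrite rename_systemM in wk.
  have frs : fixes (r \o s) G by move=> c Gc /=; rewrite fs // fr.
  (* Either the answer contains a step and absorbs [r \o s], leaving the identity as witness, or it
     is idle and [r \o s] itself becomes the witness. *)
  have [S2'' [wk' [eS|[eG eS eS']]]] := weak_hat_rename brs frs wk; exists l, S2'', n'; split=> //.
    by exists id; split; [exists id| |rewrite rename_system_eqid // eS].
  by subst; exists (r \o s).
- move=> mu l G' S2' [r [br fr pst]].
  (* The challenge comes from the lazy system renamed by [r], whereas the relation holds for its
     renaming by [s]; renaming both sides by [r \o t], with [t] the inverse of [s], turns the second
     into the first. *)
  have brt := bij_comp br bt.
  have frt : fixes (r \o t) G by move=> c Gc /=; rewrite ft // fr.
  have rel1 := related_rename brt frt rel.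
  rewrite rename_systemM (_ : (r \o t) \o s = r) in rel1; last first.
    by apply: funext => c /=; rewrite sK.
  have [k [S1' [n' [wk en rel']]]] := related_backward uv n rel1 pst.
  have [S1'' [wk' [eS|[eG eS eS']]]] := weak_hat_rename brt frt wk; exists k, S1'', n'; split=> //.
    by exists id; split; [exists id| |rewrite rename_system_eqid // eS].
  (* The idle answer leaves the eager system without the renaming [r \o t]; applying its inverse [q]
     to the pair restores the eager system and puts the renaming on the lazy side, where the
     relation permits it. *)
  subst; have [q rtK qK] := brt; have bq : bijective q by exists (r \o t).
  have fq := fixes_inv rtK frt.
  exists q; split=> //; have := related_rename bq fq rel'.
  by rewrite rename_systemM rename_system_eqid.
Qed.
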